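(* Assume $\rho>\lambda_0(1-\gamma)$ and let $K_0\in C(\mathbf S^1;(0,\infty))$. Then: (i) $V^{b_0}(K_0)=\frac{\alpha}{1-\gamma}\Big(\int_{\mathbf S^1}K_0(\theta)b_0(\theta)d\theta\Big)^{1-\gamma}$, where $\alpha=\Big[\frac{\gamma}{\rho-\lambda_0(1-\gamma)}\int_{\mathbf S^1}\eta(\theta)^{\frac{q+\gamma-1}{\gamma}}b_0(\theta)^{\frac{\gamma-1}{\gamma}}d\theta\Big]^\gamma$; (ii) the control $\hat C(t,\theta)=\Big(\int_{\mathbf S^1}K_0(\xi)b_0(\xi)d\xi\Big)(\alpha b_0(\theta))^{-1/\gamma}\eta(\theta)^{\frac{q-1}{\gamma}}e^{gt}$, with $g=\frac{\lambda_0-\rho}{\gamma}$, is optimal for the problem defining $V^{b_0}(K_0)$, and the corresponding optimal capital $\hat K$ solves (in the mild sense) the linear integro-PDE $$\partial_tK(t,\theta)=\sigma\partial^2_\theta K(t,\theta)+A(\theta)K(t,\theta)-(\alpha b_0(\theta))^{-1/\gamma}\Big(\int_{\mathbf S^1}K(t,\xi)b_0(\xi)d\xi\Big)\eta(\theta)^{\frac{q+\gamma-1}{\gamma}},\quad K(0,\cdot)=K_0.$$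
   Context: $\mathbf S^1\cong[0,2\pi]$ with endpoints identified, Lebesgue measure $d\theta$; $X=C(\mathbf S^1)$ with sup-norm. $Lx=\sigma x''+A x$, $D(L)=C^2(\mathbf S^1)$, $\sigma>0$, $A,\eta\in C(\mathbf S^1;(0,\infty))$, $q\ge0$, $\gamma\in(0,1)\cup(1,\infty)$, $\rho>0$. $\lambda_0$ is the largest (simple) eigenvalue of $L$ and $b_0>0$ its $L^2$-normalized eigenfunction. For a consumption $C\in L^1_{loc}(\mathbb R_+;C(\mathbf S^1;\mathbb R_+))$, the capital is the mild solution $K(t)=e^{tL}K_0-\int_0^te^{(t-s)L}(\eta C(s))ds$ of $\partial_tK=\sigma\partial^2_\theta K+AK-\eta C$, $K(0)=K_0$. $\mathcal A^{b_0}_{++}(K_0)=\{C:\int_{\mathbf S^1}K(t,\theta)b_0(\theta)d\theta>0\ \forall t\ge0\}$; $\mathcal J(C)=\int_0^\infty e^{-\rho t}\int_{\mathbf S^1}\frac{C(t,\theta)^{1-\gamma}}{1-\gamma}\eta(\theta)^qd\theta\,dt$; $V^{b_0}(K_0)=\sup_{C\in\mathcal A^{b_0}_{++}(K_0)}\mathcal J(C)$. *)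

(* Defs.v *)
From HB Require Import structures.
From mathcomp Require Import all_boot all_order all_algebra.
From mathcomp Require Import all_classical all_reals all_analysis.
Set Implicit Arguments. Unset Strict Implicit. Unset Printing Implicit Defensive.
Import Order.TTheory GRing.Theory Num.Theory.
Import numFieldNormedType.Exports.
Local Open Scope classical_set_scope.
Local Open Scope ring_scope.

Section Defs.
Variable R : realType.

(* S^1 = [0,2pi] with endpoints identified: functions on S^1 are
   2pi-periodic functions R -> R; integration over S^1 is over [0,2pi]. *)
Definition S1 : set R := [set th | 0 <= th <= 2 * pi].
Definition Rplus_set : set R := [set t | 0 <= t].
Definition interval0 (T : R) : set R := [set t | 0 <= t <= T].

Definition periodic (f : R -> R) : Prop := forall th, f (th + 2 * pi) = f th.

Definition Xsp (f : R -> R) : Prop := continuous f /\ periodic f.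

Definition C2per (f : R -> R) : Prop :=
  periodic f /\ (forall x, derivable f x 1) /\
  (forall x, derivable (derive1 f) x 1) /\ continuous (derive1 (derive1 f)).

Definition Lop (sigma : R) (A : R -> R) (f : R -> R) : R -> R :=
  fun th => sigma * derive1 (derive1 f) th + A th * f th.

Definition unif_conv0 (F : R -> R -> R) (g : R -> R) : Prop :=
  forall e : R, 0 < e -> exists d : R, 0 < d /\
    forall t, 0 < t < d -> forall th, `|F t th - g th| <= e.

(* S is the C0-semigroup (e^{tL})_{t>=0} on X = C(S^1) (sup norm) whose
   infinitesimal generator is L with domain D(L) = C^2(S^1). *)
Definition IsSemigroupOf (sigma : R) (A : R -> R) (S : R -> (R -> R) -> (R -> R)) : Prop :=
  (forall t x, 0 <= t -> Xsp x -> Xsp (S t x)) /\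
  (forall t (a : R) x y, 0 <= t -> Xsp x -> Xsp y ->
      S t (fun th => a * x th + y th) = (fun th => a * S t x th + S t y th)) /\
  (forall t, 0 <= t -> exists M : R, forall x (B : R), Xsp x ->
      (forall th, `|x th| <= B) -> forall th, `|S t x th| <= M * B) /\
  (forall x, Xsp x -> S 0 x = x) /\
  (forall t s x, 0 <= t -> 0 <= s -> Xsp x -> S (t + s) x = S t (S s x)) /\
  (forall x, Xsp x -> unif_conv0 (fun t => S t x) x) /\
  (forall x, Xsp x ->
     ((exists y, Xsp y /\ unif_conv0 (fun t th => (S t x th - x th) / t) y)
       <-> C2per x)) /\
  (forall x, C2per x ->
     unif_conv0 (fun t th => (S t x th - x th) / t) (Lop sigma A x)).

Definition IsPrincipalEigen (sigma : R) (A : R -> R) (lambda0 : R) (b0 : R -> R) : Prop :=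
  C2per b0 /\ (forall th, 0 < b0 th) /\
  (forall th, Lop sigma A b0 th = lambda0 * b0 th) /\
  (\int[lebesgue_measure]_(th in S1) (b0 th ^+ 2) = 1) /\
  (forall (lam : R) x, C2per x -> (exists th, x th != 0) ->
      (forall th, Lop sigma A x th = lam * x th) -> lam <= lambda0) /\
  (forall x, C2per x -> (forall th, Lop sigma A x th = lambda0 * x th) ->
      exists c : R, x = (fun th => c * b0 th)).

Definition L1loc_plus (C : R -> R -> R) : Prop :=
  (forall t, 0 <= t -> Xsp (C t) /\ forall th, 0 <= C t th) /\
  (forall th, measurable_fun Rplus_set (fun t => C t th)) /\
  (forall T, 0 <= T -> exists m : R -> R,
      lebesgue_measure.-integrable (interval0 T) (EFin \o m) /\
      forall t th, 0 <= t <= T -> C t th <= m t).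

(* mild solution K(t) = e^{tL} K0 - int_0^t e^{(t-s)L} (eta C(s)) ds *)
Definition capital (S : R -> (R -> R) -> (R -> R)) (eta K0 : R -> R)
  (C : R -> R -> R) (t th : R) : R :=
  S t K0 th -
  \int[lebesgue_measure]_(s in interval0 t) S (t - s) (fun xi => eta xi * C s xi) th.

Definition admissible_b0 (S : R -> (R -> R) -> (R -> R)) (eta b0 K0 : R -> R) :
  set (R -> R -> R) :=
  [set C | L1loc_plus C /\
     forall t, 0 <= t ->
       0 < \int[lebesgue_measure]_(th in S1) (capital S eta K0 C t th * b0 th)].

Definition util (gamma c : R) : \bar R :=
  if (c == 0) && (1 < gamma) then -oo%E
  else ((c `^ (1 - gamma)) / (1 - gamma))%:E.

Definition Jfun (rho gamma q : R) (eta : R -> R) (C : R -> R -> R) : \bar R :=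
  (\int[lebesgue_measure]_(t in Rplus_set)
     ((expR (- (rho * t)))%:E *
       \int[lebesgue_measure]_(th in S1) (util gamma (C t th) * (eta th `^ q)%:E)))%E.

Definition Vb0 (S : R -> (R -> R) -> (R -> R)) (rho gamma q : R) (eta b0 K0 : R -> R) :
  \bar R :=
  ereal_sup [set Jfun rho gamma q eta C | C in admissible_b0 S eta b0 K0].

End Defs.
Arguments S1 {R}.
Arguments Rplus_set {R}.
Arguments interval0 {R} T.

(* Main.v *)
Require Import Defs.
From HB Require Import structures.
From mathcomp Require Import all_boot all_order all_algebra.
From mathcomp Require Import all_classical all_reals all_analysis.
From mathcomp Require Import measurable_realfun.
From mathcomp Require Import ring lra.
Import Order.TTheory GRing.Theory Num.Theory.
Import numFieldNormedType.Exports.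
Local Open Scope classical_set_scope.
Local Open Scope ring_scope.

(** Pairing with the eigenfunction collapses the dynamics: L is symmetric, so
    <e^{tL} x, b0> = e^{lambda0 t} <x, b0>, first for x in C^2 and then, by
    density, for every continuous x.  Hence
      <K(t), b0> = e^{lambda0 t} (<K0, b0> - int_0^t e^{-lambda0 s} <eta C(s), b0> ds)
    and C is admissible only if the intertemporal budget constraint
      int_0^oo e^{-lambda0 s} <eta C(s), b0> ds <= <K0, b0>
    holds.  The candidate Chat exhausts the budget, and its discounted marginal
    utility is proportional to the price e^{-lambda0 t} eta b0, so the tangent
    inequality for the concave utility, integrated over time and space, gives
    J(C) <= J(Chat).

    The axioms of a strongly continuous semigroup bound each e^{tL} separately;
    the bound on compact time intervals comes from uniform boundedness. *)

Set Implicit Arguments.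
Unset Strict Implicit.

(** * Continuous functions on the circle *)

Section PeriodicFunctions.
Variable R : realType.
Implicit Types (x y f g : R -> R).

(** Two measurability gaps shape the argument. A control is measurable in time only at each fixed
    angle, whereas exchanging time and space in the pairing needs [S (t - s) (eta C(s)) th] jointly
    measurable. Interpolation at finitely many nodes closes this gap: nodes and C^2 weights do not
    depend on the function, so a bounded linear functional of a varying continuous function is a
    limit of finite sums of measurable terms. The same interpolation gives the density of C^2. The
    second gap is the utility of an arbitrary control: it is compared with its tangent bound by
    monotonicity of the integral, valid for arbitrary functions, and only the bound is actually
    integrated. The rate [g] comes from matching decay: discounted marginal utility must decay like
    the price [expR (- lambda0 * t)], so [gamma * g = lambda0 - rho]. The candidate then spends the
    aggregate capital at the constant rate [kappa = lambda0 - g = (rho - lambda0 * (1 - gamma)) /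
    gamma], positive exactly under the assumption on [rho], and [alpha] is the value that makes
    total discounted spending equal to the budget. *)

Lemma continuous_distP f : continuous f <->
  forall th (e : R), 0 < e ->
    exists2 d : R, 0 < d & forall u, `|u - th| < d -> `|f u - f th| <= e.
Proof.
split=> [cf th e e0|H th].
  have /cvgrPdist_le/(_ e e0)/nbhs_ballP[d /= d0 H] := cf th.
  exists d => // u ud; rewrite distrC; apply: H.
  by rewrite /ball/= distrC.
apply/cvgrPdist_le => e e0; have [d d0 Hd] := H th e e0.
apply/nbhs_ballP; exists d => //= u; rewrite /ball/= => ud.
by rewrite distrC; apply: Hd; rewrite distrC.
Qed.

Lemma two_pi_gt0 : 0 < 2 * pi :> R.
Proof. by rewrite mulr_gt0// pi_gt0. Qed.

Lemma periodicZ f (k : int) th : Defs.periodic f -> f (th + k%:~R * (2 * pi)) = f th.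
Proof.
move=> pf.
have pn (n : nat) u : f (u + n%:R * (2 * pi)) = f u.
  elim: n u => [|n IH] u; first by rewrite mul0r addr0.
  by rewrite -natr1 mulrDl mul1r addrA pf.
case: k => n; first exact: pn.
rewrite NegzE mulrNz mulNr -[in RHS](subrK (n.+1%:R * (2 * pi)) th).
by rewrite pn.
Qed.

(** The window is free: [a = 0] moves a point into the fundamental domain, [a = - pi] picks the
    representative of a difference whose absolute value is the arc length. *)
Lemma reduce_mod_2pi (a th : R) :
  exists k : int, a <= th + k%:~R * (2 * pi) < a + 2 * pi.
Proof.
have p0 := two_pi_gt0; exists (- Num.floor ((th - a) / (2 * pi))).
set z := (th - a) / (2 * pi).
have thE : th = a + z * (2 * pi) by rewrite /z divfK ?gt_eqF// addrC subrK.
have zfl : (Num.floor z)%:~R <= z by exact: floor_le_tmp.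
have zlt : z < (Num.floor z)%:~R + 1 by rewrite -intrD1 floorD1_gt.
rewrite mulrNz {1 2}thE mulNr -addrA -mulrBl lerDl ltrD2l.
rewrite mulr_ge0 ?subr_ge0 ?(ltW p0)//=.
by rewrite gtr_pMl// ltrBlDl.
Qed.

Lemma Xsp_bounded x : Xsp x -> exists2 B : R, 0 <= B & forall th, `|x th| <= B.
Proof.
move=> [cx px].
have cn : {within `[0, 2 * pi], continuous (fun th => `|x th|)}.
  apply: continuous_subspaceT => th.
  exact: (continuous_comp (cx th) (@norm_continuous _ _ _)).
have [c _ Hc] := EVT_max (ltW two_pi_gt0) cn.
exists `|x c| => // th; have [k /andP[k0 k1]] := reduce_mod_2pi 0 th.
by rewrite -(periodicZ k th px) Hc// in_itv/= k0/= ltW//; move: k1; rewrite add0r.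
Qed.

(** Compactness is applied with only one of the two points confined to [[0, 2 * pi]]. The other
    ranges over the line, so pairs straddling an endpoint are covered, and periodicity shifts both
    points by the same multiple of [2 * pi]. *)
Lemma Xsp_unif_continuous y (e : R) : Xsp y -> 0 < e ->
  exists2 d : R, 0 < d & forall u v, `|u - v| < d -> `|y u - y v| <= e.
Proof.
move=> [cy py] e0.
have : \forall d \near (0:R)^'+, `[0, 2 * pi] `<=`
    [set u | forall v, `|v - u| < d -> `|y v - y u| <= e].
  have /compact_near_coveringP cov := @segment_compact R 0 (2 * pi).
  apply: cov => u _.
  have [d d0 Hd] := (continuous_distP y).1 cy u (e / 2) (divr_gt0 e0 (ltr0n _ 2)).
  have d20 : 0 < d / 2 by rewrite divr_gt0.
  near=> u' d' => /= v vu'.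
  have u'u : `|u' - u| < d / 2.
    by near: u'; apply/nbhs_ballP; exists (d/2) => //= z; rewrite /ball/= distrC.
  have d'd : d' < d / 2 by near: d'; exact: nbhs_right_lt.
  rewrite -(subrK (y u) (y v)) -addrA (splitr e); apply: le_trans (ler_normD _ _) _.
  apply: lerD; last first.
    by rewrite distrC; apply: Hd; apply: lt_trans u'u _;
      rewrite ltr_pdivrMr// ltr_pMr// ltr1n.
  apply: Hd; rewrite -(subrK u' v) -addrA (splitr d).
  by apply: le_lt_trans (ler_normD _ _) _; rewrite ltrD// (lt_trans vu').
move=> Hd.
have [d [d0 Hd']] : exists d : R, 0 < d /\ `[0, 2 * pi] `<=`
    [set u | forall v, `|v - u| < d -> `|y v - y u| <= e].
  near (0:R)^'+ => d; exists d; split => //; near: d => //.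
exists d => // u v uv; have [k /andP[k0 k1]] := reduce_mod_2pi 0 v.
rewrite -(periodicZ k u py) -(periodicZ k v py).
apply: (Hd' (v + k%:~R * (2 * pi))).
  by rewrite /= in_itv/= k0/= ltW//; move: k1; rewrite add0r.
by rewrite [X in `|X|](_ : _ = u - v)//; ring.
Unshelve. all: by end_near. Qed.

Lemma Xsp_unif_closed y :
  (forall e : R, 0 < e -> exists2 x, Xsp x & forall th, `|x th - y th| <= e) ->
  Xsp y.
Proof.
move=> H; split.
  apply/continuous_distP => th e e0.
  have e30 : 0 < e / 3 by rewrite divr_gt0.
  have [x [cx px] Hx] := H _ e30.
  have [d d0 Hd] := (continuous_distP x).1 cx th _ e30.
  exists d => // u ud.
  have := Hd u ud; have := Hx u; have := Hx th.
  rewrite !ler_norml => /andP[? ?] /andP[? ?] /andP[? ?]; lra.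
move=> th; apply/eqP; rewrite -subr_eq0 -normr_le0; apply/ler_addgt0Pr => e e0.
rewrite add0r; have [x [cx px] Hx] := H _ (divr_gt0 e0 (ltr0n _ 2)).
have := Hx th; have := Hx (th + 2 * pi); rewrite px !ler_norml => /andP[? ?] /andP[? ?]; lra.
Qed.

Lemma Xsp_lin (a : R) x y : Xsp x -> Xsp y -> Xsp (fun th => a * x th + y th).
Proof.
move=> [cx px] [cy py]; split=> [th|th]; last by rewrite px py.
by apply: cvgD; [apply: cvgMr; exact: cx|exact: cy].
Qed.

Lemma Xsp_cst (a : R) : Xsp (cst a).
Proof. by split => // th; exact: cvg_cst. Qed.

Lemma XspM x y : Xsp x -> Xsp y -> Xsp (fun th => x th * y th).
Proof.
move=> [cx px] [cy py]; split=> [th|th]; last by rewrite px py.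
by apply: cvgM; [exact: cx|exact: cy].
Qed.

Lemma XspD x y : Xsp x -> Xsp y -> Xsp (fun th => x th + y th).
Proof.
move=> [cx px] [cy py]; split=> [th|th]; last by rewrite px py.
by apply: cvgD; [exact: cx|exact: cy].
Qed.

Lemma XspZ (a : R) x : Xsp x -> Xsp (fun th => a * x th).
Proof. exact: XspM (Xsp_cst a). Qed.

Lemma XspB x y : Xsp x -> Xsp y -> Xsp (fun th => x th - y th).
Proof.
move=> [cx px] [cy py]; split=> [th|th]; last by rewrite px py.
by apply: cvgB; [exact: cx|exact: cy].
Qed.

Lemma Xsp_sum (n : nat) (c : nat -> R) (phi : nat -> R -> R) :
  (forall i, Xsp (phi i)) -> Xsp (fun th => \sum_(i < n) c i * phi i th).
Proof.
move=> Hphi; elim: n => [|n IH].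
  rewrite (_ : (fun _ => _) = cst 0); first exact: Xsp_cst.
  by apply/funext => th; rewrite big_ord0.
rewrite (_ : (fun _ => _) = (fun th => c n * phi n th + \sum_(i < n) c i * phi i th)).
  exact: Xsp_lin.
by apply/funext => th; rewrite big_ord_recr/= addrC.
Qed.

End PeriodicFunctions.

(** * Bounded operators for the sup norm; uniform boundedness *)

Section UniformBoundedness.
Variable R : realType.
Implicit Types (x y : R -> R) (T : (R -> R) -> R -> R).

(** An upper bound for the operator norm, with the sup norm of [x] replaced by an arbitrary bound
    [B]. *)
Definition op_bound T (M : R) := forall x (B : R), Xsp x ->
  (forall th, `|x th| <= B) -> forall th, `|T x th| <= M * B.

Definition op_linear T := forall (a : R) x y, Xsp x -> Xsp y ->
  T (fun th => a * x th + y th) = (fun th => a * T x th + T y th).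

Lemma op_bound_le T M M' : M <= M' -> op_bound T M -> op_bound T M'.
Proof.
move=> MM' TM x B Xx xB th; apply: le_trans (TM x B Xx xB th) _.
by rewrite ler_wpM2r// (le_trans (normr_ge0 _) (xB 0)).
Qed.

Lemma op_linear0 T : op_linear T -> T (cst 0) = cst 0.
Proof.
move=> lT; have := lT (-1) (cst 0) (cst 0) (Xsp_cst 0) (Xsp_cst 0).
rewrite (_ : (fun _ => _) = cst 0); last by apply/funext => th /=; rewrite mulr0 addr0.
by move=> ->; apply/funext => th /=; rewrite mulN1r addNr.
Qed.

Lemma op_linearZ T (a : R) x : op_linear T -> Xsp x ->
  T (fun th => a * x th) = (fun th => a * T x th).
Proof.
move=> lT Xx; have := lT a x (cst 0) Xx (Xsp_cst 0).
rewrite op_linear0// => E.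
rewrite [X in T X = _](_ : _ = (fun th => a * x th + cst 0 th)).
  by rewrite E; apply/funext => th /=; rewrite addr0.
by apply/funext => th /=; rewrite addr0.
Qed.

Lemma op_linearD T x y : op_linear T -> Xsp x -> Xsp y ->
  T (fun th => x th + y th) = (fun th => T x th + T y th).
Proof.
move=> lT Xx Xy; have := lT 1 x y Xx Xy.
under eq_fun do rewrite mul1r.
by move=> ->; apply/funext => th; rewrite mul1r.
Qed.

Lemma op_linearB T x y : op_linear T -> Xsp x -> Xsp y ->
  T (fun th => x th - y th) = (fun th => T x th - T y th).
Proof.
move=> lT Xx Xy; have := lT (-1) y x Xy Xx.
under eq_fun do rewrite mulN1r addrC.
by move=> ->; apply/funext => th; rewrite mulN1r addrC.
Qed.

Lemma op_linear_sum T n (c : nat -> R) (phi : nat -> R -> R) :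
  op_linear T -> (forall i, Xsp (phi i)) ->
  T (fun th => \sum_(i < n) c i * phi i th) =
  (fun th => \sum_(i < n) c i * T (phi i) th).
Proof.
move=> lT Hphi; elim: n => [|n IH].
  rewrite (_ : (fun _ => _) = cst 0); last by apply/funext => th; rewrite big_ord0.
  by rewrite op_linear0//; apply/funext => th; rewrite big_ord0.
rewrite (_ : (fun _ => _) = (fun th => c n * phi n th + \sum_(i < n) c i * phi i th)).
  rewrite lT//; last exact: Xsp_sum.
  by rewrite IH; apply/funext => th; rewrite big_ord_recr/= addrC.
by apply/funext => th; rewrite big_ord_recr/= addrC.
Qed.

(** [M] stands for a number slightly above the operator norm, found without an infimum: if every
    bound above [K] could be shrunk by 3/4, repeated shrinking from [M0] would make [K] itself a
    bound. *)
Lemma near_optimal_op_bound T (K M0 : R) : 0 < K -> op_bound T M0 -> ~ op_bound T K ->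
  exists M, [/\ K < M, op_bound T M & ~ op_bound T (3 / 4 * M)].
Proof.
move=> K0 TM0 TK; apply: contrapT => H.
have step M : op_bound T M -> op_bound T (3 / 4 * M).
  move=> TM; have [MK|KM] := leP M K; first by have := op_bound_le MK TM.
  by apply: contrapT => nT; apply: H; exists M.
have pw n : op_bound T ((3 / 4) ^+ n * M0).
  elim: n => [|n IH]; first by rewrite expr0 mul1r.
  by rewrite exprS -mulrA; exact: step.
have M00 : 0 < M0.
  by rewrite ltNge; apply/negP => M00; apply: TK; apply: op_bound_le TM0; lra.
have : ((3 / 4 : R) ^+ n) @[n --> \oo] --> (0 : R).
  by apply: cvg_expr; rewrite ger0_norm; lra.
move=> /cvgrPdist_le/(_ (K / M0) (divr_gt0 K0 M00))[n _ /(_ n (leqnn n))/=].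
rewrite sub0r normrN ger0_norm; last by apply: exprn_ge0; lra.
by rewrite ler_pdivlMr// => /op_bound_le/(_ (pw n)).
Qed.

(** Since [2 * T z = T (x + z) - T (x - z)], one of [x + z] and [x - z] has an image at least as
    large as that of [z], whatever [T x] is; [z] is a vector of size at most [r] that violates the
    bound [K]. *)
Lemma perturb_op_bound T (K r : R) x : op_linear T -> 0 < r -> Xsp x ->
  ~ op_bound T K ->
  exists y, [/\ Xsp y, forall th, `|y th - x th| <= r &
    exists th, K * r < `|T y th|].
Proof.
move=> lT r0 Xx nTK.
have [z [Xz zr [th Hth]]] : exists z, [/\ Xsp z, forall th, `|z th| <= r &
    exists th, K * r < `|T z th|].
  apply: contrapT => H; apply: nTK => z B Xz zB th.
  have B0 : 0 <= B := le_trans (normr_ge0 _) (zB 0).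
  have [B0'|Bn0] := eqVneq B 0.
    have -> : z = cst 0.
      by apply/funext => u; apply/eqP; rewrite -normr_le0 -B0'.
    by rewrite op_linear0// B0' mulr0 normr0.
  have {Bn0}B0 : 0 < B by rewrite lt_def Bn0.
  rewrite leNgt; apply/negP => KB; apply: H.
  have rB0 : 0 <= r / B by rewrite ltW// divr_gt0.
  exists (fun u => r / B * z u); split; first exact: XspZ.
    move=> u; rewrite normrM (ger0_norm rB0).
    by rewrite -[leRHS]mulr1 -mulrA ler_pM2l// mulrC ler_pdivrMr// mul1r.
  exists th; rewrite op_linearZ// normrM (ger0_norm rB0).
  by rewrite [ltLHS]mulrC -mulrA ltr_pM2l// ltr_pdivlMl// mulrC.
have [H|H] := ltP (K * r) `|T (fun u => x u + z u) th|.
  exists (fun u => x u + z u); split; [exact: XspD| |by exists th].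
  by move=> u; rewrite addrC addKr.
exists (fun u => x u - z u); split; first exact: XspB.
  by move=> u; rewrite addrC addKr normrN.
exists th; rewrite ltNge; apply/negP => H'.
move: H H' Hth; rewrite op_linearD// op_linearB//.
set a := T x th; set b := T z th => H1 H2; apply/negP; rewrite -leNgt.
rewrite -(ler_pM2l (ltr0n R 2)) -[2 * `|b|]ger0_norm ?mulr_ge0//.
rewrite normrM normr_id -normrM.
rewrite (_ : 2 * b = (a + b) - (a - b)); last by ring.
by apply: le_trans (ler_normB _ _) _; rewrite mulr_natl mulr2n lerD.
Qed.

(* Sokal's elementary proof of the uniform boundedness theorem: move by 4^-n
   in a direction almost realising the norm of T n; the later moves add up to
   4^-n / 3 and cannot cancel the effect. *)
Lemma gliding_hump (T : nat -> (R -> R) -> R -> R) :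
  (forall n, op_linear (T n)) -> (forall n, exists M, op_bound (T n) M) ->
  (forall n, ~ op_bound (T n) (n.+1%:R * 4 ^+ n)) ->
  exists2 x, Xsp x & forall n, exists th, n.+1%:R / 4 < `|T n x th|.
Proof.
move=> lT bT nT.
have /choice[M HM] : forall n, exists M, [/\ n.+1%:R * 4 ^+ n < M,
    op_bound (T n) M & ~ op_bound (T n) (3 / 4 * M)].
  by move=> n; have [M0 TM0] := bT n; apply: near_optimal_op_bound TM0 _.
pose r n : R := (4 ^+ n)^-1.
have r0 n : 0 < r n by rewrite invr_gt0 exprn_gt0.
have rS n : r n.+1 = r n / 4 by rewrite /r exprS invfM mulrC.
have rE n : r n = (4 ^+ n)^-1 by [].
clearbody r.
have /choice[step Hstep] : forall nx : nat * (R -> R), exists y, Xsp nx.2 ->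
    [/\ Xsp y, forall th, `|y th - nx.2 th| <= r nx.1 &
      exists th, 3 / 4 * M nx.1 * r nx.1 < `|T nx.1 y th|].
  move=> [n x] /=; have [Xx|nXx] := pselect (Xsp x); last by exists x.
  have [_ _ nTM] := HM n.
  by have [y Hy] := perturb_op_bound (lT n) (r0 n) Xx nTM; exists y.
pose X := fix X n := if n is m.+1 then step (m, X m) else cst 0 : R -> R.
have XX n : Xsp (X n).
  by elim: n => [|n IH]; [exact: Xsp_cst|have [] := Hstep (n, X n) IH].
have XE n : X n.+1 = step (n, X n) by [].
clearbody X.
have XS n th : `|X n.+1 th - X n th| <= r n.
  by rewrite XE; have [_ + _] := Hstep (n, X n) (XX n); exact.
(* The right side is the geometric sum of the radii [r n], ..., [r (n + k - 1)]. *)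
have Xd n k th : `|X (n + k)%N th - X n th| <= 4 / 3 * (r n - r (n + k)%N).
  elim: k => [|k IH]; first by rewrite addn0 !subrr mulr0 normr0.
  rewrite addnS rS; move: IH (XS (n + k)%N th).
  rewrite !ler_norml => /andP[? ?] /andP[? ?]; lra.
have Xd' n m th : X n th - 4 / 3 * r n <= X m th + 4 / 3 * r m.
  have := r0 n; have := r0 m.
  have [nm|mn] := leqP n m.
    have := Xd n (m - n)%N th; rewrite subnKC// ler_norml => /andP[? ?]; lra.
  have := Xd m (n - m)%N th; rewrite (subnKC (ltnW mn)) ler_norml => /andP[? ?]; lra.
(* The pointwise limit of [X], obtained as a supremum of lower estimates; by [Xd'] each upper
   estimate [X m th + 4 / 3 * r m] bounds them all. *)
pose x th := sup [set X n th - 4 / 3 * r n | n in setT].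
have xX n th : `|X n th - x th| <= 4 / 3 * r n.
  rewrite distrC ler_norml; apply/andP; split.
    rewrite lerBrDl; apply: ub_le_sup; last by exists n.
    by exists (X n th + 4 / 3 * r n) => _ [m _ <-].
  rewrite lerBlDl; apply: ge_sup; first by exists (X n th - 4 / 3 * r n); exists n.
  by move=> _ [m _ <-].
have Xx : Xsp x.
  apply: Xsp_unif_closed => e e0.
  have : ((4^-1 : R) ^+ n) @[n --> \oo] --> (0 : R).
    by apply: cvg_expr; rewrite ger0_norm; lra.
  have e34 : 0 < 3 / 4 * e by lra.
  move=> /cvgrPdist_le/(_ _ e34)[n _ /(_ n (leqnn n))/=].
  rewrite sub0r normrN ger0_norm; last by apply: exprn_ge0; lra.
  rewrite exprVn -rE => rn; exists (X n) => // th.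
  by apply: le_trans (xX n th) _; lra.
exists x => // n.
have [_ _ [th Hth]] := Hstep (n, X n) (XX n); exists th.
have [KM TM _] := HM n.
have XB : Xsp (fun u => X n.+1 u - x u) by exact: XspB.
(* All later moves amount to [4 / 3 * r n.+1 = r n / 3], so the image of [x] keeps at least
   [(3 / 4 - 1 / 3) * M n * r n], which exceeds [5 / 12 * n.+1] and hence [n.+1 / 4]. *)
have := TM _ (r n / 3) XB _ th.
rewrite op_linearB//= => H.
have {}H : `|T n (X n.+1) th - T n x th| <= M n * (r n / 3).
  by apply: H => u; apply: le_trans (xX n.+1 u) _; rewrite rS; lra.
have : `|T n (X n.+1) th| <= M n * (r n / 3) + `|T n x th|.
  by rewrite -lerBlDr; apply: le_trans H; exact: lerB_dist.
have Mr : n.+1%:R < M n * r n by rewrite rE ltr_pdivlMr// exprn_gt0.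
move: Hth Mr; rewrite /= -XE.
rewrite mulrA -[3 / 4 * _ * _]mulrA.
by move: (M n * r n) => z *; have := ler0n R n.+1; lra.
Qed.

End UniformBoundedness.

(** * Local bounds and time continuity of the semigroup *)

Section Semigroup.
Variables (R : realType) (sigma : R) (A : R -> R) (S : R -> (R -> R) -> R -> R).
Hypothesis HS : IsSemigroupOf sigma A S.
Implicit Types x y : R -> R.

Lemma semigroup_Xsp t x : 0 <= t -> Xsp x -> Xsp (S t x).
Proof. by have [+ _] := HS; exact. Qed.

Lemma semigroup_linear t : 0 <= t -> op_linear (S t).
Proof. by move=> t0 a x y; have [_ [+ _]] := HS; exact. Qed.

Lemma semigroup_bounded t : 0 <= t -> exists M, op_bound (S t) M.
Proof. by move=> t0; have [_ [_ [+ _]]] := HS; exact. Qed.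

Lemma semigroup0 x : Xsp x -> S 0 x = x.
Proof. by have [_ [_ [_ [+ _]]]] := HS; exact. Qed.

Lemma semigroupD t s x : 0 <= t -> 0 <= s -> Xsp x -> S (t + s) x = S t (S s x).
Proof. by have [_ [_ [_ [_ [+ _]]]]] := HS; exact. Qed.

Lemma semigroup_cvg0 x : Xsp x -> unif_conv0 (fun t => S t x) x.
Proof. by have [_ [_ [_ [_ [_ [+ _]]]]]] := HS; exact. Qed.

Lemma semigroup_domain x : Xsp x ->
  (exists y, Xsp y /\ unif_conv0 (fun t th => (S t x th - x th) / t) y) ->
  C2per x.
Proof. by move=> Xx; have [_ [_ [_ [_ [_ [_ [+ _]]]]]]] := HS => /(_ x Xx)[]. Qed.

Lemma semigroup_generator x : C2per x ->
  unif_conv0 (fun t th => (S t x th - x th) / t) (Lop sigma A x).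
Proof. by have [_ [_ [_ [_ [_ [_ [_ +]]]]]]] := HS; exact. Qed.

(** Otherwise there are times [t n <= n.+1^-1] whose operators exceed the thresholds of the gliding
    hump. The resulting [x] has an unbounded orbit along times tending to 0, against
    [S t x -> x]. *)
Lemma semigroup_bounded_near0 :
  exists2 d : R, 0 < d & exists M, forall t, 0 <= t <= d -> op_bound (S t) M.
Proof.
apply: contrapT => H.
have /choice[t Ht] : forall n : nat, exists t : R,
    0 <= t <= n.+1%:R^-1 /\ ~ op_bound (S t) (n.+1%:R * 4 ^+ n).
  move=> n; apply: contrapT => H'; apply: H; exists n.+1%:R^-1; first by rewrite invr_gt0.
  exists (n.+1%:R * 4 ^+ n) => t Ht; apply: contrapT => nb.
  by apply: H'; exists t.
have t0 n : 0 <= t n by have [/andP[]] := Ht n.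
have [x Xx Hx] := @gliding_hump R (fun n => S (t n))
  (fun n => semigroup_linear (t0 n)) (fun n => semigroup_bounded (t0 n))
  (fun n => (Ht n).2).
have [B B0 xB] := Xsp_bounded Xx.
have [d [d0 Hd]] := semigroup_cvg0 Xx (ltr01 : 0 < 1 :> R).
have bd n : n.+1%:R^-1 < d -> forall th, `|S (t n) x th| <= B + 1.
  move=> nd th; have := t0 n; rewrite le_eqVlt => /predU1P[tn0|tn0].
    rewrite -tn0 semigroup0//; apply: le_trans (xB th) _; lra.
  have tnd : 0 < t n < d.
    by rewrite tn0/= (le_lt_trans _ nd)//; have [/andP[]] := Ht n.
  have := Hd _ tnd th; have := xB th.
  rewrite !ler_norml => /andP[? ?] /andP[? ?]; apply/andP; split; lra.
have [k Hk] : exists k : nat, d^-1 + 4 * (B + 1) < k.+1%:R.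
  exists (Num.truncn (d^-1 + 4 * (B + 1))); exact: truncnS_gt.
have dV0 : 0 < d^-1 by rewrite invr_gt0.
have [th Hth] := Hx k.
have kd : k.+1%:R^-1 < d by rewrite invf_plt ?posrE//; lra.
have := bd k kd th; lra.
Qed.

(** A time up to [n.+1 * d] is split into [n.+1] steps of length at most [d], each costing a factor
    [M]; taking [M >= 1] lets the larger power cover shorter times. *)
Lemma semigroup_locally_bounded (T : R) :
  exists2 M : R, 0 <= M & forall t, 0 <= t <= T -> op_bound (S t) M.
Proof.
have [d d0 [M0 HM0]] := semigroup_bounded_near0.
pose M := Num.max 1 M0.
have M1 : 1 <= M by rewrite le_max lexx.
have HM t : 0 <= t <= d -> op_bound (S t) M.
  by move=> td; apply: op_bound_le (HM0 t td); rewrite le_max lexx orbT.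
have HMn n t : 0 <= t <= n.+1%:R * d -> op_bound (S t) (M ^+ n.+1).
  elim: n t => [|n IH] t; first by rewrite mul1r expr1; exact: HM.
  move=> /andP[t0 tn]; have [td|dt] := leP t d.
    by apply: op_bound_le (HM t _); [exact: ler_eXnr|rewrite t0].
  move=> x B Xx xB th.
  have td0 : 0 <= t - d by lra.
  rewrite -(subrKC d t) (semigroupD (ltW d0) td0 Xx) exprS -mulrA.
  apply: HM; [by rewrite (ltW d0) lexx|exact: semigroup_Xsp|].
  move=> u; apply: IH => //; rewrite td0/=.
  by move: tn; rewrite -[n.+2%:R]natr1 mulrDl mul1r; lra.
exists (M ^+ (Num.truncn (T / d)).+1); first by apply: exprn_ge0; lra.
move=> t /andP[t0 tT]; apply: HMn; rewrite t0/=.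
apply: le_trans tT _; rewrite -ler_pdivrMr// ltW//; exact: truncnS_gt.
Qed.

(* By local boundedness, right continuity at 0 propagates to two-sided
   continuity on bounded time intervals. *)
Lemma semigroup_unif_continuous (T : R) x (e : R) : Xsp x -> 0 < e ->
  exists2 d : R, 0 < d & forall s t, 0 <= s <= T -> 0 <= t <= T -> `|s - t| < d ->
    forall th, `|S s x th - S t x th| <= e.
Proof.
move=> Xx e0; have [M M0 HM] := semigroup_locally_bounded T.
have M1 : 0 < M + 1 by lra.
have [d [d0 Hd]] := semigroup_cvg0 Xx (divr_gt0 e0 M1).
exists d => //.
have H s t : 0 <= s -> s <= t <= T -> t - s < d -> forall th, `|S t x th - S s x th| <= e.
  move=> s0 /andP[st tT] tsd th; move: st; rewrite le_eqVlt => /predU1P[->|st].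
    by rewrite subrr normr0 ltW.
  have ts0 : 0 <= t - s by lra.
  rewrite -[t](subrKC s t) semigroupD//.
  have XSt := semigroup_Xsp ts0 Xx.
  have -> : S s (S (t - s) x) th - S s x th =
      S s (fun u => S (t - s) x u - x u) th.
    by rewrite op_linearB//; exact: semigroup_linear.
  have sT : 0 <= s <= T by lra.
  apply: le_trans (HM s sT _ (e / (M + 1)) _ _ th) _.
  - exact: XspB.
  - by move=> u; apply: Hd; lra.
  - rewrite mulrCA ger_pMr// ler_pdivrMr//; lra.
move=> s t /andP[s0 sT] /andP[t0 tT] st th.
have [le_st|lt_ts] := leP s t.
  rewrite distrC; apply: H => //; first by rewrite le_st.
  by move: st; rewrite ltr_norml => /andP[? ?]; lra.
apply: H => //; first by rewrite ltW.
by move: st; rewrite ltr_norml => /andP[? ?]; lra.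
Qed.

End Semigroup.

(** * Calculus of C^2 functions *)

Section C2Functions.
Variable R : realType.
Implicit Types (x y f g : R -> R).

(** The derivatives are carried as explicit witnesses, so that closure under sums, products and
    inverses is a computation with [is_derive]. Periodicity is checked separately when passing to
    [C2per]. *)
Definition C2 f := exists f1 f2 : R -> R,
  [/\ forall th : R, is_derive th 1 f (f1 th),
      forall th : R, is_derive th 1 f1 (f2 th) & continuous f2].

Lemma is_derive_continuous f (df : R -> R) :
  (forall th : R, is_derive th 1 f (df th)) -> continuous f.
Proof.
move=> H th; apply: differentiable_continuous; apply/derivable1_diffP.
by have [] := H th.
Qed.

Lemma C2_C2per f : Defs.periodic f -> C2 f -> C2per f.
Proof.
move=> pf [f1 [f2 [H1 H2 c2]]].
have E1 : derive1 f = f1 by apply/funext => th; rewrite derive1E; have [] := H1 th.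
have E2 : derive1 f1 = f2 by apply/funext => th; rewrite derive1E; have [] := H2 th.
rewrite /C2per E1 E2; split; [by []|split; [|split; [|by []]]] => th.
  by have [] := H1 th.
by have [] := H2 th.
Qed.

Lemma C2per_is_derive f : C2per f ->
  (forall th : R, is_derive th 1 f (derive1 f th)) /\
  (forall th : R, is_derive th 1 (derive1 f) (derive1 (derive1 f) th)).
Proof.
move=> [_ [d1 [d2 _]]]; split=> th; rewrite derive1E; apply/derivableP.
  exact: d1.
exact: d2.
Qed.

Lemma C2per_Xsp f : C2per f -> Xsp f.
Proof.
move=> Hf; have [pf _] := Hf; split => //.
by have [/is_derive_continuous] := C2per_is_derive Hf.
Qed.

Lemma derive1_periodic f : (forall th, derivable f th 1) -> Defs.periodic f ->
  Defs.periodic (derive1 f).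
Proof.
move=> df pf th.
have D : is_derive th 1 (f \o (fun u => u + 2 * pi)) (derive1 f (th + 2 * pi) * 1).
  apply: is_derive1_comp; first by rewrite derive1E; apply/derivableP; exact: df.
  by apply: is_derive_eq; rewrite addr0.
have E : f \o (fun u => u + 2 * pi) = f by apply/funext => u /=; rewrite pf.
by rewrite -[LHS]mulr1 [RHS]derive1E; rewrite E in D; have [_ <-] := D.
Qed.

Lemma Lop_Xsp sigma A f : Xsp A -> C2per f -> Xsp (Lop sigma A f).
Proof.
move=> XA Hf; have Xf := C2per_Xsp Hf.
have [pf [d1 [d2 c2]]] := Hf.
apply: (@Xsp_lin R sigma _ (fun th => A th * f th)); last exact: XspM.
by split; [exact: c2|exact: derive1_periodic d2 (derive1_periodic d1 pf)].
Qed.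

Lemma C2_cst (c : R) : C2 (cst c).
Proof.
exists (cst 0), (cst 0); split=> [th|th|th]; [exact: is_derive_cst..|exact: cvg_cst].
Qed.

Lemma C2D f g : C2 f -> C2 g -> C2 (fun th => f th + g th).
Proof.
move=> [f1 [f2 [F1 F2 cF]]] [g1 [g2 [G1 G2 cG]]].
exists (fun th => f1 th + g1 th), (fun th => f2 th + g2 th); split => th.
- exact: is_deriveD.
- exact: is_deriveD.
- by apply: cvgD; [exact: cF|exact: cG].
Qed.

Lemma C2M f g : C2 f -> C2 g -> C2 (fun th => f th * g th).
Proof.
move=> [f1 [f2 [F1 F2 cF]]] [g1 [g2 [G1 G2 cG]]].
exists (fun th => f th * g1 th + g th * f1 th),
  (fun th => (f th * g2 th + g1 th * f1 th) + (g th * f2 th + f1 th * g1 th)).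
have cf := is_derive_continuous F1; have cg := is_derive_continuous G1.
have cf1 := is_derive_continuous F2; have cg1 := is_derive_continuous G2.
split => th.
- exact: is_deriveM.
- by apply: is_deriveD; exact: is_deriveM.
- apply: cvgD; apply: cvgD; apply: cvgM;
  by [exact: cF|exact: cG|exact: cf|exact: cg|exact: cf1|exact: cg1].
Qed.

Lemma C2V f : (forall th, f th != 0) -> C2 f -> C2 (fun th => (f th)^-1).
Proof.
move=> f0 [f1 [f2 [F1 F2 cF]]].
have D1 th : is_derive (th : R) 1 (fun u => (f u)^-1) (- (f1 th * (f th)^-1 * (f th)^-1)).
  have [df eqf] := F1 th; apply: DeriveDef; first exact: derivableV.
  by rewrite deriveV// eqf /GRing.scale/= expr2 invfM; ring.
have cf1 := is_derive_continuous F2; have cV := is_derive_continuous D1.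
pose v1 th := - (f1 th * (f th)^-1 * (f th)^-1).
exists v1, (fun th => - ((f1 th * (f th)^-1) * v1 th + (f th)^-1 * (f1 th * v1 th + (f th)^-1 * f2 th))).
split => [//|th|th].
  apply: is_deriveN; apply: is_deriveM; exact: is_deriveM.
have cv1 : continuous v1.
  move=> u; apply: cvgN; apply: cvgM; last exact: cV.
  by apply: cvgM; [exact: cf1|exact: cV].
apply: cvgN; apply: cvgD; apply: cvgM => //; [|exact: cv1|exact: cV|].
  by apply: cvgM; [exact: cf1|exact: cV].
apply: cvgD; apply: cvgM; by [exact: cf1|exact: cv1|exact: cV|exact: cF].
Qed.

(** For large [m] these periodic functions concentrate at [a]; normalised by their sum over a grid
    they become the interpolation weights. *)
Lemma C2_expcos (m a : R) : C2 (fun th => expR (m * cos (th - a))).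
Proof.
have D (th : R) : is_derive th 1 (fun u : R => u - a) 1.
  by apply: is_derive_eq; rewrite subr0.
have Dc (th : R) : is_derive th 1 (fun u => cos (u - a)) (- sin (th - a)).
  by have := @is_derive1_comp R cos (fun u => u - a) th _ _ (is_derive_cos _) (D th); rewrite mulr1.
have Ds (th : R) : is_derive th 1 (fun u => sin (u - a)) (cos (th - a)).
  by have := @is_derive1_comp R sin (fun u => u - a) th _ _ (is_derive_sin _) (D th); rewrite mulr1.
have cc := is_derive_continuous Dc; have cs := is_derive_continuous Ds.
pose E th := expR (m * cos (th - a)).
have DE (th : R) : is_derive th 1 E (E th * (m * - sin (th - a))).
  exact: (is_derive1_comp (is_derive_expR _) (is_deriveZ m (Dc th))).
have cE := is_derive_continuous DE.
exists (fun th => E th * (m * - sin (th - a))),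
  (fun th => E th * (m * - cos (th - a)) + (m * - sin (th - a)) * (E th * (m * - sin (th - a)))).
split => [//|th|th].
  by apply: is_deriveM; apply: is_deriveZ.
have cs' : (m * - sin (z - a)) @[z --> th] --> (m * - sin (th - a)).
  by apply: cvgMr; apply: cvgN; exact: cs.
apply: cvgD; apply: cvgM => //; [exact: cE| |].
  by apply: cvgMr; apply: cvgN; exact: cc.
by apply: cvgM => //; exact: cE.
Qed.

Lemma C2_sum n (h : nat -> R -> R) : (forall i, C2 (h i)) ->
  C2 (fun th => \sum_(i < n) h i th).
Proof.
move=> H; elim: n => [|n IH].
  by under eq_fun do rewrite big_ord0; exact: C2_cst.
by under eq_fun do rewrite big_ord_recr/=; exact: C2D.
Qed.

Lemma C2per_sum n (c : nat -> R) (h : nat -> R -> R) : (forall i, C2per (h i)) ->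
  C2per (fun th => \sum_(i < n) c i * h i th).
Proof.
move=> H; apply: C2_C2per.
  by move=> th; apply: eq_bigr => i _; have [-> _] := H i.
apply: (@C2_sum n (fun i th => c i * h i th)) => i.
apply: C2M; first exact: C2_cst.
have [D1 D2] := C2per_is_derive (H i); have [_ [_ [_ c2]]] := H i.
by exists (derive1 (h i)), (derive1 (derive1 (h i))).
Qed.

End C2Functions.

(** * Smooth interpolation on the circle *)

Section Approximation.
Variable R : realType.
Implicit Types (y : R -> R).

Lemma cos_periodic (a : R) (k : int) : cos (a + k%:~R * (2 * pi)) = cos a.
Proof.
apply: periodicZ => th; rewrite mulr_natl; exact: cosD2pi.
Qed.

(* 1 - cos (u - v) is a smooth periodic substitute for the distance on the circle. *)
Lemma Xsp_chord_continuous y (e : R) : Xsp y -> 0 < e ->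
  exists2 d : R, 0 < d & forall u v, 1 - cos (u - v) < d -> `|y u - y v| <= e.
Proof.
move=> Xy e0; have [d d0 Hd] := Xsp_unif_continuous Xy e0.
have p0 := pi_gt0 R.
(* Cosine is strictly decreasing on [[0, pi]], so capping at [pi] lets a comparison of cosines be
   read as a comparison of arc lengths. *)
pose d' := Num.min d pi.
have d'0 : 0 < d' by rewrite lt_min d0.
have d'p : d' <= pi by rewrite ge_min lexx orbT.
have cd' : cos d' < 1 by rewrite -cos0 ltr_cos// in_itv/= ?lexx ?(ltW p0)// (ltW d'0).
exists (1 - cos d') => [|u v uv]; first lra.
have [k /andP[k0 k1]] := reduce_mod_2pi (- pi) (u - v).
set w := u - v + _ in k0 k1.
have cw : cos d' < cos `|w|.
  have -> : cos `|w| = cos (u - v).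
    by rewrite -(cos_periodic (u - v) k) -/w; case: (ger0P w) => _ //; rewrite cosN.
  lra.
have wp : `|w| <= pi by rewrite ler_norml k0/=; lra.
have wd : `|w| < d'.
  by move: cw; rewrite ltr_cos// in_itv/= ?normr_ge0 ?(ltW d'0).
rewrite -(periodicZ k u (proj2 Xy)); apply: Hd.
rewrite (_ : _ - v = w); last by rewrite /w; ring.
by rewrite (lt_le_trans wd)// ge_min lexx.
Qed.

Lemma grid_dense (e : R) : 0 < e -> exists N : nat,
  forall th, exists j : 'I_N, 1 - cos (th - j%:R * (2 * pi / N%:R)) <= e.
Proof.
move=> e0.
have [d d0 Hd] := (continuous_distP (@cos R)).1 (@continuous_cos R) 0 e e0.
pose N := (Num.truncn (2 * pi / d)).+1.
have pp := two_pi_gt0 R.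
have N0 : 0 < N%:R :> R by [].
have Nd : 2 * pi / N%:R < d.
  by rewrite ltr_pdivrMr// [ltRHS]mulrC -ltr_pdivrMr//; exact: truncnS_gt.
have h0 : 0 < 2 * pi / N%:R :> R by rewrite divr_gt0.
exists N => th; have [k /andP[k0 k1]] := reduce_mod_2pi 0 th.
set w := th + _ in k0 k1.
have jge0 : 0 <= w / (2 * pi / N%:R) by rewrite divr_ge0// ltW.
have jN : (Num.truncn (w / (2 * pi / N%:R)) < N)%N.
  rewrite truncn_lt_nat// ltr_pdivrMr// mulrCA divff ?gt_eqF// mulr1.
  by rewrite add0r in k1.
exists (Ordinal jN) => /=.
have := truncn_itv jge0; set j := Num.truncn _ => /andP[j0 j1].
rewrite ler_pdivlMr// in j0; rewrite ltr_pdivrMr// in j1.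
have -> : cos (th - j%:R * (2 * pi / N%:R)) = cos (w - j%:R * (2 * pi / N%:R)).
  by rewrite -(cos_periodic _ k) addrAC.
have := Hd (w - j%:R * (2 * pi / N%:R)); rewrite cos0 subr0 => H.
suff /H : `|w - j%:R * (2 * pi / N%:R)| < d by rewrite ler_norml => /andP[? ?]; lra.
move: j1; rewrite -natr1 mulrDl mul1r => j1.
rewrite ger0_norm; lra.
Qed.

(** The [phi i] are the weights [expR (m * cos (th - p i))] divided by their sum. Some node lies
    within chord distance [e / 2] of [th]; a node at distance at least [e] has, relative to it,
    weight at most [expR (- (m * (e / 2)))]. With [m = 2 * N / e ^+ 2] the far nodes together weigh
    at most [N * expR (- (N / e)) <= e], and each contributes an error of at most [2 * B] per unit
    weight. *)
Lemma approximate_unit (e : R) : 0 < e -> exists (N : nat) (p : nat -> R) (phi : nat -> R -> R),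
  (forall i, C2per (phi i)) /\
  forall y (B c : R), (forall th, `|y th| <= B) ->
    (forall u v, 1 - cos (u - v) < e -> `|y u - y v| <= c) ->
    forall th, `|\sum_(i < N) y (p i) * phi i th - y th| <= c + 2 * B * e.
Proof.
move=> e0; have [N HN] := grid_dense (divr_gt0 e0 (ltr0n R 2)).
pose p i : R := i%:R * (2 * pi / N%:R).
pose m : R := 2 * N%:R / e ^+ 2.
pose E i th : R := expR (m * cos (th - p i)).
have E0 i th : 0 < E i th by exact: expR_gt0.
pose W th := \sum_(i < N) E i th.
have N0 : (0 < N)%N by have [[j jN] _] := HN 0; exact: leq_ltn_trans jN.
have WE th (j : 'I_N) : E j th <= W th.
  by rewrite /W (bigD1 j)//= lerDl sumr_ge0// => i _; exact: ltW.
have W0 th : 0 < W th := lt_le_trans (E0 _ th) (WE th (Ordinal N0)).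
have pE i : Defs.periodic (E i).
  by move=> th; rewrite /E -(cos_periodic (th - p i) 1) mul1r addrAC.
have m0 : 0 <= m by rewrite divr_ge0 ?mulr_ge0 ?ler0n ?exprn_ge0 ?(ltW e0).
have NE : N%:R * expR (- (m * (e / 2))) <= e.
  rewrite (_ : m * (e / 2) = N%:R / e); last by rewrite /m; field; rewrite gt_eqF.
  have x0 : 0 < N%:R / e by rewrite divr_gt0// ltr0n.
  rewrite expRN ler_pdivrMr ?expR_gt0//.
  apply: le_trans (ler_wpM2l (ltW e0) (expR_ge1Dx (N%:R / e))).
  by rewrite mulrDr mulrCA divff ?gt_eqF// !mulr1 lerDr ltW.
exists N, p, (fun i th => E i th * (W th)^-1); split.
  move=> i; apply: C2_C2per.
    by move=> th; rewrite /W pE; congr (_ * _^-1); apply: eq_bigr => j _; rewrite pE.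
  apply: C2M; first exact: C2_expcos.
  apply: C2V; first by move=> th; rewrite gt_eqF.
  by apply: C2_sum => j; exact: C2_expcos.
move=> y B c yB yc th.
have B0 : 0 <= B := le_trans (normr_ge0 _) (yB 0).
have sum1 : \sum_(i < N) E i th / W th = 1.
  by rewrite -mulr_suml -/(W th) divff// (gt_eqF (W0 th)).
rewrite -[y th]mulr1 -sum1 mulr_sumr -sumrB.
apply: le_trans (ler_norm_sum _ _ _) _.
have c0 : 0 <= c by apply: le_trans (yc 0 0 _); rewrite ?subrr ?cos0 ?subrr.
have bnd (i : 'I_N) : `|y (p i) * (E i th / W th) - y th * (E i th / W th)| <=
    c * (E i th / W th) + 2 * B * expR (- (m * (e / 2))).
  have q0 : 0 <= E i th / W th by rewrite divr_ge0// ltW.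
  rewrite -mulrBl normrM [`|_ / _|]ger0_norm//.
  have [near|far] := ltP (1 - cos (p i - th)) e.
    apply: le_trans (ler_wpM2r q0 (yc _ _ near)) _.
    by rewrite lerDl !mulr_ge0// expR_ge0.
  apply: le_trans (_ : 2 * B * (E i th / W th) <= _).
    apply: ler_wpM2r => //; apply: le_trans (ler_normB _ _) _.
    by rewrite mulr_natl mulr2n lerD.
  apply: le_trans (_ : 2 * B * expR (- (m * (e / 2))) <= _); last first.
    by rewrite lerDr mulr_ge0.
  apply: ler_wpM2l; first by rewrite mulr_ge0.
  have [j Hj] := HN th.
  rewrite ler_pdivrMr//; apply: le_trans (ler_wpM2l (expR_ge0 _) (WE th j)).
  rewrite /E -expRD ler_expR -cosN opprB.
  rewrite -mulrN -mulrDr; apply: ler_wpM2l => //.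
  rewrite -/(p j) in Hj; lra.
apply: le_trans (ler_sum _ (fun i _ => bnd i)) _.
rewrite big_split/= -mulr_sumr sum1 mulr1 lerD2l sumr_const card_ord.
by rewrite -[leLHS]mulr_natr -mulrA ler_wpM2l ?mulr_ge0// mulrC.
Qed.

(** The order of quantifiers is the point: one sequence of finite-rank operators, chosen before [y],
    converges strongly to the identity. This gives density of C^2 and also measurability for
    families of functions. *)
Lemma C2per_interpolation : exists (N : nat -> nat) (p : nat -> nat -> R)
    (phi : nat -> nat -> R -> R),
  (forall n i, C2per (phi n i)) /\
  forall y (e : R), Xsp y -> 0 < e -> \forall n \near \oo,
    forall th, `|\sum_(i < N n) y (p n i) * phi n i th - y th| <= e.
Proof.
have /choice[F HF] : forall n : nat, exists F : nat * (nat -> R) * (nat -> R -> R),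
    (forall i, C2per (F.2 i)) /\
    forall y (B c : R), (forall th, `|y th| <= B) ->
      (forall u v, 1 - cos (u - v) < n.+1%:R^-1 -> `|y u - y v| <= c) ->
      forall th, `|\sum_(i < F.1.1) y (F.1.2 i) * F.2 i th - y th| <=
        c + 2 * B * n.+1%:R^-1.
  move=> n; have n0 : 0 < n.+1%:R^-1 :> R by rewrite invr_gt0.
  by have [N [p [phi H]]] := approximate_unit n0; exists (N, p, phi).
exists (fun n => (F n).1.1), (fun n => (F n).1.2), (fun n => (F n).2).
split=> [n i|y e Xy e0]; first by have [+ _] := HF n; exact.
have [B B0 yB] := Xsp_bounded Xy.
have e20 : 0 < e / 2 by rewrite divr_gt0.
have [d d0 Hd] := Xsp_chord_continuous Xy e20.
have B1 : 0 < 4 * B + 1 by lra.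
near=> n => th.
have nd : n.+1%:R^-1 < d.
  by near: n; exact: near_infty_natSinv_lt (PosNum d0).
have ne : n.+1%:R^-1 < e / (4 * B + 1).
  by near: n; exact: near_infty_natSinv_lt (PosNum (divr_gt0 e0 B1)).
have [_ /(_ y B (e / 2) yB _ th)] := HF n.
move=> /(_ _)/le_trans; apply.
  by move=> u v uv; apply: Hd; exact: lt_trans uv nd.
move: ne; rewrite ltr_pdivlMr// => ne.
have : 0 < n.+1%:R^-1 :> R by rewrite invr_gt0.
move: (n.+1%:R^-1) ne => z ne z0; lra.
Unshelve. all: by end_near. Qed.

End Approximation.

(** * Pairing with a function on the circle; symmetry of L *)

Section CircleIntegral.
Variable R : realType.
Local Notation mu := (@lebesgue_measure R).
Implicit Types x y b : R -> R.

Lemma S1E : @S1 R = `[0, 2 * pi]%classic.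
Proof. by apply/seteqP; split=> th /=; rewrite in_itv. Qed.

Lemma measurable_S1 : measurable (@S1 R : set (measurableTypeR R)).
Proof. by rewrite S1E; exact: measurable_itv. Qed.

Lemma lebesgue_measure_S1 : @lebesgue_measure R S1 = (2 * pi)%:E.
Proof. by rewrite S1E lebesgue_measure_itv/= lte_fin two_pi_gt0 -EFinB subr0. Qed.

Lemma integrable_S1 x : continuous x -> mu.-integrable (@S1 R) (EFin \o x).
Proof.
move=> cx; rewrite S1E; apply: continuous_compact_integrable.
  exact: segment_compact.
exact: continuous_subspaceT.
Qed.

Definition pairing b x : R := \int[mu]_(th in S1) (x th * b th).

Lemma integrable_pairing b x : Xsp b -> Xsp x ->
  mu.-integrable (@S1 R) (EFin \o (fun th => x th * b th)).
Proof. by move=> Xb Xx; apply: integrable_S1; have [] := XspM Xx Xb. Qed.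

Lemma pairing_linear b (a : R) x y : Xsp b -> Xsp x -> Xsp y ->
  pairing b (fun th => a * x th + y th) = a * pairing b x + pairing b y.
Proof.
move=> Xb Xx Xy; rewrite /pairing -RintegralZl//; last 2 first.
- exact: measurable_S1.
- exact: integrable_pairing.
rewrite -RintegralD//; last 3 first.
- exact: measurable_S1.
- apply: (@integrable_S1 (fun th => a * (x th * b th))).
  by have [] := XspZ a (XspM Xx Xb).
- exact: integrable_pairing.
by apply: eq_Rintegral => th _; rewrite mulrDl mulrA.
Qed.

Lemma pairing_bound b : Xsp b -> exists2 K : R, 0 <= K &
  forall x (B : R), Xsp x -> (forall th, `|x th| <= B) -> `|pairing b x| <= K * B.
Proof.
move=> Xb; have cnb : continuous (fun th => `|b th|).
  by move=> th; exact: (continuous_comp (Xb.1 th) (@norm_continuous _ _ _)).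
exists (\int[mu]_(th in S1) `|b th|); first by apply: Rintegral_ge0.
move=> x B Xx xB; apply: le_trans (le_normr_Rintegral _ _) _.
- exact: measurable_S1.
- exact: integrable_pairing.
rewrite mulrC -RintegralZl//; [|exact: measurable_S1|exact: integrable_S1].
apply: le_Rintegral => //.
- exact: measurable_S1.
- apply: integrable_S1 => th.
  exact: (continuous_comp ((XspM Xx Xb).1 th) (@norm_continuous _ _ _)).
- apply: integrable_S1 => th.
  by apply: cvgMr; exact: cnb.
- by move=> th _; rewrite normrM ler_wpM2r.
Qed.

Lemma Rintegral_S1_derivative (F f : R -> R) :
  (forall th : R, is_derive th 1 F (f th)) -> continuous f -> Defs.periodic F ->
  \int[mu]_(th in S1) f th = 0.
Proof.
move=> DF cf pF; rewrite /Rintegral S1E (@continuous_FTC2 R f F)//.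
- by rewrite -[2 * pi]add0r pF subee.
- exact: two_pi_gt0.
- exact: continuous_subspaceT.
- have cF := is_derive_continuous DF.
  split=> [th _| |]; first by have [] := DF th.
    exact/cvg_at_right_filter/cF.
  exact/cvg_at_left_filter/cF.
- by move=> th _; rewrite derive1E; have [] := DF th.
Qed.

(** Lagrange's identity: the potential cancels, and the difference of the integrands is the
    derivative of the periodic function [sigma * (x' * b - x * b')]. *)
Lemma pairing_Lop_symmetric sigma A x b : Xsp A -> C2per x -> C2per b ->
  pairing b (Lop sigma A x) = pairing (Lop sigma A b) x.
Proof.
move=> XA Hx Hb.
have Xx := C2per_Xsp Hx; have Xb := C2per_Xsp Hb.
have XLx := Lop_Xsp sigma XA Hx; have XLb := Lop_Xsp sigma XA Hb.
apply/eqP; rewrite -subr_eq0; apply/eqP.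
rewrite /pairing -RintegralB//; last 3 first.
- exact: measurable_S1.
- exact: integrable_pairing.
- exact: integrable_pairing.
have [Dx1 Dx2] := C2per_is_derive Hx; have [Db1 Db2] := C2per_is_derive Hb.
pose F th := sigma * (derive1 x th * b th - x th * derive1 b th).
apply: (@Rintegral_S1_derivative F).
- move=> th; have := is_deriveZ sigma
    (is_deriveB (is_deriveM (Dx2 th) (Db1 th)) (is_deriveM (Dx1 th) (Db2 th))).
  move=> H; apply: is_derive_eq H _.
  by rewrite /Lop /GRing.scale/=; ring.
- move=> th; have [cLxb _] := XspM XLx Xb; have [cxLb _] := XspM Xx XLb.
  by apply: cvgB; [exact: cLxb|exact: cxLb].
- have [px [dx _]] := Hx; have [pb [db _]] := Hb.
  by move=> th; rewrite /F px pb !derive1_periodic.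
Qed.

End CircleIntegral.

(** * A discrete argument for scalar linear growth *)

Section ExponentialGrowth.
Variable R : realType.

(** A constancy criterion based on forward increments alone, which is what the generator supplies.
    Because [d] is uniform in [s], the errors add up along equal steps of total length [T]. *)
Lemma small_increments_cst (psi : R -> R) (T : R) : 0 <= T ->
  (forall e : R, 0 < e -> exists2 d : R, 0 < d & forall s h, 0 <= s -> 0 < h < d ->
    s + h <= T -> `|psi (s + h) - psi s| <= e * h) ->
  psi T = psi 0.
Proof.
rewrite le_eqVlt => /predU1P[<-//|T0] H.
apply/eqP; rewrite -subr_eq0 -normr_le0; apply/ler_addgt0Pr => e e0; rewrite add0r.
have [d d0 Hd] := H _ (divr_gt0 e0 T0).
pose n := (Num.truncn (T / d)).+1.
have n0 : 0 < n%:R :> R by [].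
pose h := T / n%:R.
have h0 : 0 < h by rewrite divr_gt0.
have hd : h < d.
  by rewrite /h ltr_pdivrMr// [ltRHS]mulrC -ltr_pdivrMr//; exact: truncnS_gt.
have nh : n%:R * h = T by rewrite /h mulrC divfK// gt_eqF.
suff Hk k : (k <= n)%N -> `|psi (k%:R * h) - psi 0| <= e / T * (k%:R * h).
  by have := Hk n (leqnn n); rewrite nh divfK// gt_eqF.
elim: k => [_|k IH kn]; first by rewrite mul0r mulr0 subrr normr0.
have {IH} := IH (ltnW kn).
have kh0 : 0 <= k%:R * h by rewrite mulr_ge0// ltW.
have khT : k%:R * h + h <= T.
  by rewrite -nh -[X in _ + X]mul1r -mulrDl natr1 ler_pM2r// ler_nat.
have hh : 0 < h < d by rewrite h0.
have := Hd _ _ kh0 hh khT.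
rewrite -natr1 mulrDl mul1r [in X in _ -> _ -> X]mulrDr.
by rewrite !ler_norml => /andP[? ?] /andP[? ?]; lra.
Qed.

(** From [expR u <= (1 - u)^-1] the remainder is at most [u ^+ 2 / (1 - u)], and
    [1 - u >= 1 / 2]. *)
Lemma expR_quadratic (u : R) : `|u| <= 2^-1 -> `|expR u - 1 - u| <= 2 * u ^+ 2.
Proof.
move=> u2; have u1 := expR_ge1Dx u; have u3 := expR_ge1Dx (- u).
rewrite ger0_norm; last lra.
move: u2; rewrite ler_norml => /andP[? ?].
have : expR u * (1 - u) <= 1.
  by rewrite -ler_pdivlMl ?expR_gt0// mulr1 -expRN.
nra.
Qed.

(** Integrating factor: [expR (- lam * s) * phi s] has increments of order o(h), hence is
    constant. *)
Lemma exponential_growth (phi : R -> R) (lam T F : R) : 0 <= T ->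
  (forall s, 0 <= s <= T -> `|phi s| <= F) ->
  (forall e : R, 0 < e -> exists2 d : R, 0 < d & forall s h, 0 <= s -> 0 < h < d ->
    s + h <= T -> `|phi (s + h) - phi s - h * (lam * phi s)| <= e * h) ->
  phi T = expR (lam * T) * phi 0.
Proof.
move=> T0 phiF H.
have F0 : 0 <= F by apply: le_trans (normr_ge0 _) (phiF 0 _); rewrite lexx.
pose D := expR (`|lam| * T).
have D0 : 0 < D := expR_gt0 _.
suff : expR (- lam * T) * phi T = expR (- lam * 0) * phi 0.
  rewrite mulr0 expR0 mul1r => <-.
  by rewrite mulrA -expRD mulNr subrr expR0 mul1r.
apply: (@small_increments_cst (fun s => expR (- lam * s) * phi s)) => // e e0.
have e1 : 0 < e / (2 * D) by rewrite divr_gt0// mulr_gt0.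
have [d d0 Hd] := H _ e1.
have l1 : 0 < `|lam| + 1 by have := normr_ge0 lam; lra.
(* Half of [e * h] pays for the defect of [phi], amplified by at most [D]. The other half pays for
   the quadratic remainder of the exponential, at most [c * h / 2 * h], whence the restriction
   [h < e / c]. *)
pose c := 4 * D * (F + 1) * (`|lam| + 1) ^+ 2.
have c0 : 0 < c by rewrite !mulr_gt0 ?exprn_gt0//; lra.
exists (Num.min d (Num.min ((2 * (`|lam| + 1))^-1) (e / c))).
  by rewrite !lt_min d0 invr_gt0 divr_gt0// mulr_gt0.
move=> s h s0 /andP[h0]; rewrite !lt_min => /and3P[hd hl hc] shT.
have sT : 0 <= s <= T by rewrite s0/=; lra.
have hd' : 0 < h < d by rewrite h0.
have {Hd} := Hd s h s0 hd' shT.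
have E : expR (- lam * s) = expR (- lam * (s + h)) * expR (lam * h).
  by rewrite -expRD; congr expR; ring.
rewrite E; set a := expR (- lam * (s + h)).
have a0 : 0 < a := expR_gt0 _.
have aD : a <= D.
  rewrite ler_expR; apply: le_trans (ler_norm _) _.
  rewrite normrM normrN ler_wpM2l// ger0_norm//; lra.
have lh : `|lam * h| <= (`|lam| + 1) * h.
  by rewrite normrM (gtr0_norm h0) ler_pM2r//; lra.
have lh2 : `|lam * h| <= 2^-1.
  apply: le_trans lh _; move: hl; rewrite -[X in h < X]mul1r ltr_pdivlMr ?mulr_gt0//; lra.
have q := expR_quadratic lh2.
have q2 : (lam * h) ^+ 2 <= ((`|lam| + 1) * h) ^+ 2.
  by rewrite -[leLHS]real_normK ?num_real// lerXn2r ?nnegrE// mulr_ge0// ltW.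
move=> Hphi.
rewrite (_ : a * phi (s + h) - a * expR (lam * h) * phi s =
  a * (phi (s + h) - phi s - h * (lam * phi s)) -
  a * ((expR (lam * h) - 1 - lam * h) * phi s)); last by ring.
apply: le_trans (ler_normB _ _) _; rewrite !normrM (gtr0_norm a0).
have H1 : a * `|phi (s + h) - phi s - h * (lam * phi s)| <= e / 2 * h.
  apply: le_trans (ler_pM (ltW a0) (normr_ge0 _) aD Hphi) _.
  by rewrite (_ : D * _ = e / 2 * h)//; field; rewrite gt_eqF.
have H2 : a * (`|expR (lam * h) - 1 - lam * h| * `|phi s|) <= e / 2 * h.
  apply: (@le_trans _ _ (D * (2 * ((`|lam| + 1) * h) ^+ 2 * (F + 1)))).
    apply: ler_pM; [exact: ltW|exact: mulr_ge0|exact: aD|].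
    apply: ler_pM => //; first by apply: le_trans q _; lra.
    by apply: le_trans (phiF s sT) _; lra.
  rewrite (_ : D * _ = (c * h) / 2 * h); last by rewrite /c; field.
  rewrite ler_pM2r// ler_pM2r ?invr_gt0//.
  by move: hc; rewrite ltr_pdivlMr// mulrC => /ltW.
lra.
Qed.

End ExponentialGrowth.

(** * The semigroup seen through the eigenfunction *)

Section SemigroupPairing.
Variables (R : realType) (sigma : R) (A : R -> R) (S : R -> (R -> R) -> R -> R).
Hypotheses (XA : Xsp A) (HS : IsSemigroupOf sigma A S).
Variables (lambda0 : R) (b0 : R -> R).
Hypothesis Hb : IsPrincipalEigen sigma A lambda0 b0.
Implicit Types x y : R -> R.

Lemma unif_conv0_unique (F : R -> R -> R) x y :
  unif_conv0 F x -> unif_conv0 F y -> x = y.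
Proof.
move=> Fx Fy; apply/funext => th; apply/eqP; rewrite -subr_eq0 -normr_le0.
apply/ler_addgt0Pr => e e0; rewrite add0r.
have e2 : 0 < e / 2 by rewrite divr_gt0.
have [d [d0 Hd]] := Fx _ e2; have [d' [d'0 Hd']] := Fy _ e2.
pose t := Num.min d d' / 2.
have m0 : 0 < Num.min d d' by rewrite lt_min d0.
have td : t < d.
  have : Num.min d d' <= d by rewrite ge_min lexx.
  rewrite /t; lra.
have td' : t < d'.
  have : Num.min d d' <= d' by rewrite ge_min lexx orbT.
  rewrite /t; lra.
have t0 : 0 < t by rewrite divr_gt0.
have tt : 0 < t < d by rewrite t0.
have tt' : 0 < t < d' by rewrite t0.
have := Hd t tt th; have := Hd' t tt' th.
rewrite !ler_norml => /andP[? ?] /andP[? ?]; lra.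
Qed.

(** [S h] and [S t] commute, so the difference quotient of [S t x] is [S t] applied to that of [x],
    and boundedness of [S t] passes to the limit. The description of the domain converts existence
    of this limit into C^2 regularity. *)
Lemma semigroup_generator_comm t x : 0 <= t -> C2per x ->
  C2per (S t x) /\ Lop sigma A (S t x) = S t (Lop sigma A x).
Proof.
move=> t0 Hx; have Xx := C2per_Xsp Hx; have XLx := Lop_Xsp sigma XA Hx.
have lS := semigroup_linear HS t0.
have cv : unif_conv0 (fun h th => (S h (S t x) th - S t x th) / h) (S t (Lop sigma A x)).
  move=> e e0; have [M HM] := semigroup_bounded HS t0.
  have M1 : 0 < `|M| + 1 by have := normr_ge0 M; lra.
  have [d [d0 Hd]] := semigroup_generator HS Hx (divr_gt0 e0 M1).
  exists d; split=> // h hd th; have h0 : 0 <= h by move: hd => /andP[/ltW].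
  have XSh := semigroup_Xsp HS h0 Xx.
  rewrite -(semigroupD HS h0 t0 Xx) [h + t]addrC (semigroupD HS t0 h0 Xx).
  pose z u := (h^-1 * (S h x u - x u)) - Lop sigma A x u.
  have -> : (S t (S h x) th - S t x th) / h - S t (Lop sigma A x) th = S t z th.
    rewrite /z op_linearB//; last by apply: XspZ; exact: XspB.
    by rewrite op_linearZ ?op_linearB// ?(mulrC h^-1)//; exact: XspB.
  have Xz : Xsp z by apply: XspB => //; apply: XspZ; exact: XspB.
  apply: le_trans (HM z (e / (`|M| + 1)) Xz _ th) _.
    by move=> u; rewrite /z mulrC; exact: Hd.
  rewrite mulrCA ger_pMr// ler_pdivrMr// mul1r.
  by apply: le_trans (ler_norm _) _; lra.
have XSt := semigroup_Xsp HS t0 Xx.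
have C2S : C2per (S t x).
  apply: (semigroup_domain HS XSt); exists (S t (Lop sigma A x)); split => //.
  by apply: (semigroup_Xsp HS).
by split => //; exact: unif_conv0_unique (semigroup_generator HS C2S) cv.
Qed.

Lemma b0_C2per : C2per b0. Proof. by have [] := Hb. Qed.

Lemma b0_gt0 th : 0 < b0 th. Proof. by have [_ [+ _]] := Hb; exact. Qed.

Lemma b0_Xsp : Xsp b0. Proof. exact: C2per_Xsp b0_C2per. Qed.

Lemma pairing_Lop x : C2per x ->
  pairing b0 (Lop sigma A x) = lambda0 * pairing b0 x.
Proof.
move=> Hx; rewrite (pairing_Lop_symmetric _ XA Hx b0_C2per) /pairing.
rewrite -RintegralZl//; last 2 first.
- exact: measurable_S1.
- exact: integrable_pairing b0_Xsp (C2per_Xsp Hx).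
by apply: eq_Rintegral => th _; have [_ [_ [-> _]]] := Hb; rewrite mulrCA.
Qed.

Lemma pairing_semigroup_C2per t x : 0 <= t -> C2per x ->
  pairing b0 (S t x) = expR (lambda0 * t) * pairing b0 x.
Proof.
move=> t0 Hx; have Xx := C2per_Xsp Hx; have XLx := Lop_Xsp sigma XA Hx.
have [K K0 HK] := pairing_bound b0_Xsp.
have [M M0 HM] := semigroup_locally_bounded HS t.
have [B B0 xB] := Xsp_bounded Xx.
rewrite -[in RHS](semigroup0 HS Xx).
apply: (@exponential_growth R (fun s => pairing b0 (S s x)) lambda0 t (K * (M * B))) => //.
  move=> s /[dup] st /andP[s0 _]; apply: HK; first by apply: (semigroup_Xsp HS).
  exact: HM.
move=> e e0; have KM1 : 0 < K * M + 1 by have := mulr_ge0 K0 M0; lra.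
have [d [d0 Hd]] := semigroup_generator HS Hx (divr_gt0 e0 KM1).
exists d => // s h s0 hd sht.
have /andP[h0 _] := hd.
have st : 0 <= s <= t by rewrite s0/=; lra.
have lS := semigroup_linear HS s0.
have XSh := semigroup_Xsp HS (ltW h0) Xx.
have XSs := semigroup_Xsp HS s0 Xx.
have [C2S LS] := semigroup_generator_comm s0 Hx.
(* [z] is the first-order defect at time 0. The defect at time [s] is [S s z], so the local bound on
   the semigroup makes the estimate uniform in [s]. *)
pose z u := (S h x u - x u) - h * Lop sigma A x u.
have Xz : Xsp z by apply: XspB; [exact: XspB|exact: XspZ].
have XSz := semigroup_Xsp HS s0 Xz.
rewrite -pairing_Lop//.
have -> : pairing b0 (S (s + h) x) - pairing b0 (S s x) -
    h * pairing b0 (Lop sigma A (S s x)) = pairing b0 (S s z).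
  have Ez : S s z = (fun u => S (s + h) x u - S s x u - h * Lop sigma A (S s x) u).
    rewrite /z op_linearB//; [|exact: XspB|exact: XspZ].
    by rewrite op_linearB// op_linearZ// LS (semigroupD HS s0 (ltW h0)).
  have XLS : Xsp (Lop sigma A (S s x)) by exact: Lop_Xsp.
  have XSsh : Xsp (S (s + h) x) by apply: (semigroup_Xsp HS) => //; lra.
  have E1 : pairing b0 (S (s + h) x) =
      pairing b0 (fun u => h * Lop sigma A (S s x) u + (1 * S s x u + S s z u)).
    by congr pairing; rewrite Ez; apply/funext => u; ring.
  rewrite E1 (pairing_linear _ b0_Xsp XLS (Xsp_lin 1 XSs XSz)).
  by rewrite (pairing_linear _ b0_Xsp XSs XSz); ring.
apply: le_trans (HK (S s z) (M * (e / (K * M + 1) * h)) XSz _) _.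
  apply: HM => // u.
  have := Hd h hd u; rewrite -(ler_pM2r h0) -[X in _ * X <= _](gtr0_norm h0) -normrM.
  by rewrite mulrBl divfK ?gt_eqF// [_ * h in X in `|X|]mulrC.
rewrite !mulrA ler_pM2r// ler_pdivrMr// [leLHS]mulrC ler_pM2l//; lra.
Qed.

Lemma pairing_semigroup t x : 0 <= t -> Xsp x ->
  pairing b0 (S t x) = expR (lambda0 * t) * pairing b0 x.
Proof.
move=> t0 Xx; have [K K0 HK] := pairing_bound b0_Xsp.
have [M M0 HM] := semigroup_locally_bounded HS t.
have [N [p [phi [Hphi Happ]]]] := C2per_interpolation R.
pose E := expR (lambda0 * t); have E0 : 0 < E := expR_gt0 _.
apply/eqP; rewrite -subr_eq0 -normr_le0; apply/ler_addgt0Pr => e e0; rewrite add0r.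
(* For the approximation error [z], [K * M] controls the pairing of [S t z] and [E * K] that of
   [E * z]; the 1 keeps [c] positive. *)
pose c := K * M + E * K + 1.
have c0 : 0 < c by have := mulr_ge0 K0 M0; have := mulr_ge0 (ltW E0) K0; rewrite /c; lra.
have [n _ /(_ n (leqnn n)) Hn] := Happ x _ Xx (divr_gt0 e0 c0).
set y := (fun th => \sum_(i < N n) x (p n i) * phi n i th).
have Cy : C2per y by apply: (@C2per_sum R (N n) (fun i => x (p n i))) => i; exact: Hphi.
have Xy := C2per_Xsp Cy.
pose z th := y th - x th.
have Xz : Xsp z by exact: XspB.
have lS := semigroup_linear HS t0.
have pB u v : Xsp u -> Xsp v ->
    pairing b0 (fun th => u th - v th) = pairing b0 u - pairing b0 v.
  move=> Xu Xv; rewrite (_ : (fun th => _) = (fun th => -1 * v th + u th)).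
    by rewrite (pairing_linear _ b0_Xsp)// mulN1r addrC.
  by apply/funext => th; rewrite mulN1r addrC.
have E1 : pairing b0 (S t x) = E * pairing b0 y - pairing b0 (S t z).
  rewrite /z (op_linearB lS Xy Xx).
  rewrite (pB _ _ (semigroup_Xsp HS t0 Xy) (semigroup_Xsp HS t0 Xx)).
  by rewrite (pairing_semigroup_C2per t0 Cy) opprB [RHS]addrC subrK.
have E2 : pairing b0 x = pairing b0 y - pairing b0 z.
  by rewrite /z (pB _ _ Xy Xx) opprB [RHS]addrC subrK.
rewrite -/E E1 E2.
rewrite (_ : _ - E * _ = E * pairing b0 z - pairing b0 (S t z)); last by ring.
apply: le_trans (ler_normB _ _) _; rewrite normrM (gtr0_norm E0).
have H1 := HK z _ Xz Hn.
have tt : 0 <= t <= t by rewrite t0 lexx.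
have H2 := HK _ _ (semigroup_Xsp HS t0 Xz) (HM t tt z _ Xz Hn).
have H3 : c * (e / c) = e by rewrite mulrC divfK// gt_eqF.
have H4 : 0 < e / c by rewrite divr_gt0.
have H5 := ler_wpM2l (ltW E0) H1.
move: H2 H3 H4 H5; rewrite /c; move: (e / _) => w; rewrite !mulrA; lra.
Qed.

End SemigroupPairing.

(** * Integral comparison and Fubini under domination *)

Section IntegralMonotone.
Context d (T : measurableType d) (R : realType) (mu : {measure set T -> \bar R}).
Local Open Scope ereal_scope.
Import HBNNSimple.

(* The integral is a supremum over simple functions, so f and g may be non-measurable. *)
Lemma le_integral_pointwise (D : set T) (f g : T -> \bar R) :
  (forall x, D x -> f x <= g x) -> \int[mu]_(x in D) f x <= \int[mu]_(x in D) g x.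
Proof.
move=> fg.
have le0 (u v : T -> \bar R) : (forall x, D x -> 0 <= u x) ->
    (forall x, D x -> u x <= v x) -> \int[mu]_(x in D) u x <= \int[mu]_(x in D) v x.
  move=> u0 uv; rewrite !ge0_integralE//; last first.
    by move=> x Dx; exact: le_trans (u0 x Dx) (uv x Dx).
  apply: ereal_sup_le => _ [h hu <-]; exists h => // x; apply: le_trans (hu x) _; rewrite /patch.
  by case: ifPn => //; rewrite inE => /uv.
rewrite integralE [leRHS]integralE; apply: leeB; apply: le0 => x Dx.
- exact: funepos_ge0.
- by rewrite !funeposE ge_max !le_max lexx orbT fg.
- exact: funeneg_ge0.
- by rewrite !funenegE ge_max !le_max lexx orbT leeN2 fg.
Qed.

End IntegralMonotone.

Section DominatedFubini.
Variable R : realType.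
Local Notation mu := (@lebesgue_measure R).
Local Notation mR := (measurableTypeR R).
Variables (D1 D2 : set mR) (F : R -> R -> R) (k : R -> R).
Hypotheses (mD1 : measurable D1) (mD2 : measurable D2) (fD2 : (mu D2 < +oo)%E).
Hypothesis mF : measurable_fun (D2 `*` D1) (fun z : mR * mR => F z.2 z.1).
Hypothesis ik : mu.-integrable D1 (EFin \o k).
Hypothesis Fk : forall s th, D1 s -> D2 th -> `|F s th| <= k s.

Lemma dominated_integrable2 s : D1 s -> mu.-integrable D2 (EFin \o F s).
Proof.
move=> D1s; apply: (@le_integrable _ _ _ _ _ mD2 _ (EFin \o cst (k s))).
- apply/measurable_EFinP.
  apply: (@measurable_comp _ _ _ _ _ _ (D2 `*` D1) (fun z : mR * mR => F z.2 z.1) _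
    (fun th : mR => (th, s) : mR * mR)) => //.
  + exact: measurableX.
  + by move=> _ [th D2th <-].
  + by apply: measurable_funTS; exact: pair2_measurable.
- by move=> th D2th; rewrite /= lee_fin (le_trans (Fk D1s D2th))// ler_norm.
- apply: measurable_bounded_integrable => //; exists `|k s|.
  by split; [exact: num_real|move=> u su th _; exact: ltW].
Qed.

Lemma dominated_integrable1 th : D2 th -> mu.-integrable D1 (EFin \o F ^~ th).
Proof.
move=> D2th; apply: le_integrable ik => //.
- apply/measurable_EFinP.
  apply: (@measurable_comp _ _ _ _ _ _ (D2 `*` D1) (fun z : mR * mR => F z.2 z.1) _
    (fun s : mR => (th, s) : mR * mR)) => //.
  + exact: measurableX.
  + by move=> _ [s D1s <-].
  + by apply: measurable_funTS; exact: pair1_measurable.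
- move=> s D1s; rewrite /= lee_fin; apply: le_trans (Fk D1s D2th) _.
  exact: ler_norm.
Qed.

(** Extension by zero to the plane, the form in which Fubini applies. Points are ordered [(th, s)],
    whereas [F] takes [s] first. *)
Let G (z : mR * mR) : \bar R := ((EFin \o (fun z => F z.2 z.1)) \_ (D2 `*` D1)) z.

Let mG : measurable_fun setT G.
Proof.
apply/(measurable_restrictT _ _).1; first exact: measurableX.
exact/measurable_EFinP.
Qed.

Let GE1 s : D1 s -> (fun th => G (th, s)) = (EFin \o F s) \_ D2.
Proof.
move=> D1s; apply/funext => th; rewrite /G /patch/=.
by rewrite in_setX/= [in X in _ && X]mem_set// andbT.
Qed.

Let GE1' s : ~ D1 s -> (fun th => G (th, s)) = cst 0%E.
Proof.
move=> D1s; apply/funext => th; rewrite /G /patch/=.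
by rewrite in_setX/= [in X in _ && X]memNset// andbF.
Qed.

Let GE2 th : D2 th -> (fun s => G (th, s)) = (EFin \o F ^~ th) \_ D1.
Proof.
move=> D2th; apply/funext => s; rewrite /G /patch/=.
by rewrite in_setX/= mem_set.
Qed.

Let GE2' th : ~ D2 th -> (fun s => G (th, s)) = cst 0%E.
Proof.
move=> D2th; apply/funext => s; rewrite /G /patch/=.
by rewrite in_setX/= memNset.
Qed.

(** With [th] integrated first, the inner integral of the absolute value is at most [k s] times the
    finite measure of [D2]. *)
Let iG : (mu \x mu)%E.-integrable setT G.
Proof.
apply/integrable21ltyP => //.
have ib : mu.-integrable D1 (EFin \o (fun s => k s * fine (mu D2))).
  have := integrableZr mD1 (fine (mu D2)) ik.
  by apply: eq_integrable => // s _; rewrite /= EFinM.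
have /integrableP[_ ib'] := ib.
apply: le_lt_trans ib'; rewrite [leRHS]integral_mkcond.
apply: le_integral_pointwise => s _.
have [D1s|nD1s] := pselect (D1 s); last first.
  rewrite (_ : (fun y => _) = cst 0%E).
    rewrite integral0 /patch; case: ifPn => //.
  by apply/funext => th; have /(congr1 (@^~ th))/= -> := GE1' nD1s; rewrite abse0.
rewrite /patch mem_set//=.
apply: (@le_trans _ _ (\int[mu]_(th in D2) (k s)%:E)%E).
  rewrite [leRHS]integral_mkcond; apply: le_integral_pointwise => th _.
  have /(congr1 (@^~ th)) -> := GE1 D1s; rewrite /patch.
  case: ifPn => [|_]; last by rewrite abse0.
  by rewrite inE => D2th; rewrite /= lee_fin Fk.
rewrite integral_cst// -[X in (_ * X)%E]fineK; last by rewrite ge0_fin_numE.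
by rewrite -EFinM lee_fin ler_norm.
Qed.

Lemma Rintegral_dominated1E s : D1 s ->
  (\int[mu]_(th in D2) F s th)%:E = (\int[mu]_th G (th, s))%E.
Proof.
move=> D1s; rewrite /Rintegral fineK; last first.
  exact: integrable_fin_num (dominated_integrable2 D1s).
by rewrite integral_mkcond -GE1.
Qed.

Lemma Rintegral_dominated2E th : D2 th ->
  (\int[mu]_(s in D1) F s th)%:E = (\int[mu]_s G (th, s))%E.
Proof.
move=> D2th; rewrite /Rintegral fineK; last first.
  exact: integrable_fin_num (dominated_integrable1 D2th).
by rewrite integral_mkcond -GE2.
Qed.

Lemma integrable_dominated_Rintegral :
  mu.-integrable D2 (EFin \o (fun th => \int[mu]_(s in D1) F s th)).
Proof.
apply: (@eq_integrable _ _ _ mu D2 mD2 (fubini_F mu G)).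
  by move=> th; rewrite inE => D2th /=; rewrite Rintegral_dominated2E.
apply: (integrableS measurableT) => //.
exact: integrable_fubini_F.
Qed.

Lemma dominated_Fubini :
  \int[mu]_(th in D2) \int[mu]_(s in D1) F s th =
  \int[mu]_(s in D1) \int[mu]_(th in D2) F s th.
Proof.
rewrite {1 3}/Rintegral; congr fine.
transitivity (\int[mu]_th \int[mu]_s G (th, s))%E.
  rewrite integral_mkcond; apply: eq_integral => th _; rewrite /patch.
  case: ifPn; first by rewrite inE => D2th; exact: Rintegral_dominated2E.
  by rewrite notin_setE => /GE2' ->; rewrite integral0.
rewrite Fubini//.
rewrite [RHS]integral_mkcond; apply: eq_integral => s _; rewrite /patch.
case: ifPn; first by rewrite inE => D1s; rewrite Rintegral_dominated1E.
by rewrite notin_setE => /GE1' ->; rewrite integral0.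
Qed.

End DominatedFubini.

(** * Measurability of functionals along a family *)

Section MeasurableFamilies.
Context d (T : measurableType d) (R : realType).

(* Interpolating y w at finitely many points reduces measurability to finite sums. *)
Lemma measurable_functional_family (D : set T) (y : T -> R -> R)
    (L : T -> (R -> R) -> R) :
  (forall w, D w -> Xsp (y w)) ->
  (forall th, measurable_fun D (fun w => y w th : measurableTypeR R)) ->
  (forall w, D w -> op_linear (fun x (_ : R) => L w x)) ->
  (forall w, D w -> exists M, op_bound (fun x (_ : R) => L w x) M) ->
  (forall x, Xsp x -> measurable_fun D (fun w => L w x : measurableTypeR R)) ->
  measurable_fun D (fun w => L w (y w) : measurableTypeR R).
Proof.
move=> Xy my linL bL mL.
have [N [p [phi [Hphi Happ]]]] := C2per_interpolation R.
have Xphi n i : Xsp (phi n i) := C2per_Xsp (Hphi n i).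
apply: (@measurable_fun_cvg _ _ _ D
  (fun n w => \sum_(i < N n) y w (p n i) * L w (phi n i))).
  by move=> n; apply: measurable_sum => i; apply: measurable_funM; [exact: my|exact: mL].
move=> w Dw; apply/cvgrPdist_le => e e0.
have [M HM] := bL w Dw; have M1 : 0 < `|M| + 1 by have := normr_ge0 M; lra.
near=> n.
have Hn : forall th, `|\sum_(i < N n) y w (p n i) * phi n i th - y w th| <= e / (`|M| + 1).
  by near: n; apply: Happ; [exact: Xy|rewrite divr_gt0].
have Xs : Xsp (fun th => \sum_(i < N n) y w (p n i) * phi n i th).
  exact: (@Xsp_sum R (N n) (fun i => y w (p n i))).
have lin := linL w Dw.
have E1 : L w (fun th => \sum_(i < N n) y w (p n i) * phi n i th) =
    \sum_(i < N n) y w (p n i) * L w (phi n i).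
  have := @op_linear_sum R _ (N n) (fun i => y w (p n i)) _ lin (Xphi n).
  by move=> /(congr1 (@^~ 0)).
have E2 := congr1 (@^~ 0) (op_linearB lin Xs (Xy w Dw)).
rewrite distrC -E1; move: E2 => /= <-.
apply: le_trans (HM _ _ (XspB Xs (Xy w Dw)) Hn 0) _.
rewrite mulrCA ger_pMr// ler_pdivrMr// mul1r.
by apply: le_trans (ler_norm _) _; lra.
Unshelve. all: by end_near. Qed.

End MeasurableFamilies.

(** * The aggregated capital *)

Section Capital.
Variables (R : realType) (sigma : R) (A : R -> R) (S : R -> (R -> R) -> R -> R).
Hypotheses (XA : Xsp A) (HS : IsSemigroupOf sigma A S).
Variables (lambda0 : R) (b0 : R -> R).
Hypothesis Hb : IsPrincipalEigen sigma A lambda0 b0.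
Variables (eta : R -> R) (C : R -> R -> R).
Hypotheses (Xeta : Xsp eta) (HC : L1loc_plus C).
Local Notation mu := (@lebesgue_measure R).
Local Notation mR := (measurableTypeR R).

Let y s xi := eta xi * C s xi.

Lemma interval0E (t : R) : interval0 t = `[0, t]%classic.
Proof. by apply/seteqP; split=> s /=; rewrite in_itv. Qed.

Lemma measurable_interval0 (t : R) : measurable (interval0 t : set mR).
Proof. by rewrite interval0E; exact: measurable_itv. Qed.

Lemma Rplus_setE : @Rplus_set R = `[0, +oo[%classic.
Proof. by apply/seteqP; split=> s /=; rewrite in_itv/= andbT. Qed.

Lemma measurable_Rplus_set : measurable (@Rplus_set R : set mR).
Proof. by rewrite Rplus_setE; exact: measurable_itv. Qed.

Lemma interval0_sub (t : R) : interval0 t `<=` @Rplus_set R.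
Proof. by move=> s /andP[]. Qed.

Lemma effective_consumption_Xsp s : 0 <= s -> Xsp (fun xi => eta xi * C s xi).
Proof. by move=> s0; apply: XspM => //; have [/(_ s s0)[]] := HC. Qed.

Lemma measurable_effective_consumption th :
  measurable_fun (@Rplus_set R : set mR) (fun s => eta th * C s th).
Proof.
by apply: measurable_funM => //; have [_ [+ _]] := HC; exact.
Qed.

Lemma effective_consumption_bound t : 0 <= t -> exists2 k : R -> R,
  mu.-integrable (interval0 t) (EFin \o k) &
  forall s th, 0 <= s <= t -> `|eta th * C s th| <= k s.
Proof.
move=> t0; have [_ [_ /(_ t t0)[m [im Hm]]]] := HC.
have [B B0 etaB] := Xsp_bounded Xeta.
exists (fun s => B * m s).
  have := integrableZl (measurable_interval0 t) B im.
  by apply: eq_integrable => //; exact: measurable_interval0.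
move=> s th st; have /andP[s0 _] := st.
have [/(_ s s0)[_ C0] _] := HC.
by rewrite normrM ler_pM// ger0_norm// Hm.
Qed.

Lemma measurable_semigroup_orbit t x th : 0 <= t -> Xsp x ->
  measurable_fun (interval0 t : set mR) (fun s => S (t - s) x th : mR).
Proof.
move=> t0 Xx; apply: subspace_continuous_measurable_fun.
  exact: measurable_interval0.
apply/subspace_continuousP => s Ds; apply/cvgrPdist_le => e e0.
have [d d0 Hd] := semigroup_unif_continuous HS t Xx e0.
apply/nbhs_ballP; exists d => //= u su Du.
apply: Hd; [move: Ds => /= /andP[? ?]; lra|move: Du => /= /andP[? ?]; lra|].
rewrite (_ : _ - _ = u - s); last by ring.
by rewrite /ball/= distrC in su.
Qed.

Lemma op_linear_eval (th : R) : op_linear (fun (x : R -> R) (_ : R) => x th).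
Proof. by []. Qed.

(** The interpolation criterion is used twice: the outer use replaces [y s] by a fixed [x]; the
    inner one, with point evaluation as the functional, separates time from angle in
    [S (t - s) x th], where continuity in each variable suffices. *)
Lemma measurable_capital_integrand t : 0 <= t ->
  measurable_fun ((S1 : set mR) `*` (interval0 t : set mR))
    (fun z : mR * mR => S (t - z.2) (y z.2) z.1).
Proof.
move=> t0.
have sub0 (z : mR * mR) : (S1 `*` interval0 t) z -> 0 <= t - z.2.
  by move=> [_ /= /andP[? ?]]; lra.
apply: (@measurable_functional_family _ _ R _ (fun z : mR * mR => y z.2)
  (fun (z : mR * mR) x => S (t - z.2) x z.1)).
- by move=> z [_ /andP[z0 _]]; exact: effective_consumption_Xsp.
- move=> th; apply: (@measurable_comp _ _ _ _ _ _ (@Rplus_set R : set mR)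
    (fun s : mR => y s th : mR) _ (snd : mR * mR -> mR)).
  + exact: measurable_Rplus_set.
  + by move=> _ [z [_ /interval0_sub ?] <-].
  + exact: measurable_effective_consumption.
  + exact: measurable_funTS.
- move=> z Dz a u v Xu Xv; apply/funext => _.
  by rewrite (semigroup_linear HS (sub0 z Dz)).
- move=> z Dz; have [M HM] := semigroup_bounded HS (sub0 z Dz).
  by exists M => x B Xx xB _; exact: HM.
- move=> x Xx.
  apply: (@measurable_functional_family _ _ R _ (fun z : mR * mR => S (t - z.2) x)
    (fun (z : mR * mR) x => x z.1)).
  + by move=> z Dz; apply: (semigroup_Xsp HS) => //; exact: sub0 Dz.
  + move=> th; apply: (@measurable_comp _ _ _ _ _ _ (interval0 t : set mR)
      (fun s : mR => S (t - s) x th : mR) _ (snd : mR * mR -> mR)).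
    * exact: measurable_interval0.
    * by move=> _ [z [_ ?] <-].
    * exact: measurable_semigroup_orbit.
    * exact: measurable_funTS.
  + by move=> z _; exact: op_linear_eval.
  + by move=> z _; exists 1 => u B Xu uB _; rewrite mul1r.
  + move=> u [cu _]; apply: measurable_funTS.
    apply: (measurableT_comp (f := u : mR -> mR)) => //.
    exact: continuous_measurable_fun.
Qed.

Lemma measurable_pairing_consumption :
  measurable_fun (@Rplus_set R : set mR) (fun s => pairing b0 (y s) : mR).
Proof.
have Xb := b0_Xsp Hb.
apply: (@measurable_functional_family _ _ R _ y (fun _ x => pairing b0 x)).
- by move=> s; exact: effective_consumption_Xsp.
- exact: measurable_effective_consumption.
- by move=> s _ a u v Xu Xv; apply/funext => _; rewrite pairing_linear.
- move=> s _; have [K _ HK] := pairing_bound Xb.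
  by exists K => x B Xx xB _; exact: HK.
- by move=> x _; exact: measurable_cst.
Qed.

Lemma integrable_pairing_consumption (c t : R) : 0 <= t ->
  mu.-integrable (interval0 t) (EFin \o (fun s => expR (c * s) * pairing b0 (y s))).
Proof.
move=> t0; have Xb := b0_Xsp Hb; have [K K0 HK] := pairing_bound Xb.
have [k ik Hk] := effective_consumption_bound t0.
have ik' := integrableZl (measurable_interval0 t) (expR (`|c| * t) * K) ik.
apply: le_integrable ik' => //.
- exact: measurable_interval0.
- apply/measurable_EFinP; apply: measurable_funM; last first.
    apply: measurable_funS measurable_pairing_consumption.
      exact: measurable_Rplus_set.
    exact: interval0_sub.
  apply: measurable_funTS; apply: continuous_measurable_fun => s.
  by apply: continuous_comp; [apply: cvgMr; exact: cvg_id|exact: continuous_expR].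
- move=> s st; have /andP[s0 st'] := st; rewrite /= lee_fin !normrM.
  rewrite -[leRHS]mulrA !(ger0_norm (expR_ge0 _)) (ger0_norm K0).
  apply: ler_pM => //.
  + rewrite ler_expR; apply: le_trans (ler_norm _) _.
    by rewrite normrM ler_wpM2l// ger0_norm.
  + apply: le_trans (HK _ (k s) (effective_consumption_Xsp s0) _) _.
      by move=> th; exact: Hk.
    by rewrite ler_wpM2l// ler_norm.
Qed.

(** After the exchange of time and space, the eigenfunction turns each [S (t - s)] into the scalar
    [expR (lambda0 * (t - s))]. *)
Lemma pairing_capital (K0 : R -> R) t : Xsp K0 -> 0 <= t ->
  \int[mu]_(th in S1) (capital S eta K0 C t th * b0 th) =
  expR (lambda0 * t) * (pairing b0 K0 -
    \int[mu]_(s in interval0 t) (expR (- lambda0 * s) * pairing b0 (y s))).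
Proof.
move=> XK0 t0; have Xb := b0_Xsp Hb.
have [B B0 bB] := Xsp_bounded Xb.
have [k ik Hk] := effective_consumption_bound t0.
have [M M0 HM] := semigroup_locally_bounded HS t.
have mI := measurable_interval0 t; have mS := @measurable_S1 R.
pose F s th := S (t - s) (y s) th * b0 th.
have bS s th : interval0 t s -> `|S (t - s) (y s) th| <= M * k s.
  move=> /andP[s0 st]; apply: HM; [lra|exact: effective_consumption_Xsp|].
  by move=> u; apply: Hk; rewrite s0.
have mSI : measurable_fun ((S1 : set mR) `*` (interval0 t : set mR))
    (fun z : mR * mR => S (t - z.2) (y z.2) z.1).
  exact: measurable_capital_integrand.
have fS : (mu (S1 : set mR) < +oo)%E by rewrite lebesgue_measure_S1 ltry.
have ik1 : mu.-integrable (interval0 t) (EFin \o (fun s => M * k s)).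
  have := integrableZl mI M ik; exact: eq_integrable.
have ik2 : mu.-integrable (interval0 t) (EFin \o (fun s => M * k s * B)).
  have := integrableZr mI B ik1; exact: eq_integrable.
have mF : measurable_fun ((S1 : set mR) `*` (interval0 t : set mR))
    (fun z : mR * mR => F z.2 z.1).
  apply: measurable_funM => //; apply: measurable_funTS.
  apply: (measurableT_comp (f := b0 : mR -> mR)) => //.
  by apply: continuous_measurable_fun; exact: Xb.1.
have Fk s th : interval0 t s -> S1 th -> `|F s th| <= M * k s * B.
  by move=> st _; rewrite normrM ler_pM// bS.
have XSK := semigroup_Xsp HS t0 XK0.
transitivity (\int[mu]_(th in S1) (S t K0 th * b0 th -
    \int[mu]_(s in interval0 t) F s th)).
  apply: eq_Rintegral => th; rewrite inE => Sth.
  rewrite /capital mulrBl; congr (_ - _); rewrite -RintegralZr//.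
  exact: (dominated_integrable1 mI mS mSI ik1 (fun s u Is _ => bS s u Is)).
rewrite RintegralB//; last 2 first.
- exact: integrable_pairing.
- exact: (integrable_dominated_Rintegral mI mS fS mF ik2 Fk).
rewrite (dominated_Fubini mI mS fS mF ik2 Fk).
rewrite -[X in X - _]/(pairing b0 (S t K0)) (pairing_semigroup XA HS Hb t0 XK0).
rewrite mulrBr; congr (_ - _).
rewrite -RintegralZl//; last exact: integrable_pairing_consumption.
apply: eq_Rintegral => s; rewrite inE => /andP[s0 st].
rewrite -[LHS]/(pairing b0 (S (t - s) (y s))).
rewrite (pairing_semigroup XA HS Hb); [|lra|exact: effective_consumption_Xsp].
by rewrite mulrA -expRD; congr (expR _ * _); ring.
Qed.

End Capital.

(** * Exponential densities and passage to the half-line *)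

Section ExponentialIntegrals.
Variable R : realType.
Local Notation mu := (@lebesgue_measure R).
Local Notation mR := (measurableTypeR R).
Variable kappa : R.
Hypothesis kappa0 : 0 < kappa.

Let f (t : R) := kappa * expR (- kappa * t).
Let F (t : R) := - expR (- kappa * t).

Let DF (t : R) : is_derive t 1 F (f t).
Proof.
have D := is_derive1_comp (is_derive_expR (- kappa * t))
  (is_deriveZ (- kappa) (is_derive_id t (1 : R))).
apply: is_derive_eq (is_deriveN D) _.
by rewrite /f /GRing.scale/= mulr1; ring.
Qed.

Let cF : continuous F := is_derive_continuous DF.

Let cf : continuous f.
Proof.
move=> t; apply: cvgMr.
apply: (@continuous_comp _ _ _ (fun s => - kappa * s) expR); last exact: continuous_expR.
by apply: cvgMr; exact: cvg_id.
Qed.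

Lemma integral_exp_decay :
  (\int[mu]_(t in Rplus_set) (kappa * expR (- kappa * t))%:E = 1)%E.
Proof.
rewrite Rplus_setE (@ge0_continuous_FTC2y R f F 0 0)//.
- by rewrite /F mulr0 expR0 -EFinB sub0r opprK.
- by move=> t _; rewrite mulr_ge0 ?expR_ge0// ltW.
- exact: continuous_subspaceT.
- rewrite -oppr0; apply: cvgN.
  rewrite (_ : (fun x => expR (- kappa * x)) =
               (fun z => expR (- z)) \o (fun z => kappa * z)); last first.
    by apply: eq_fun => x; rewrite mulNr.
  apply: (@cvg_comp _ _ _ _ _ _ (pinfty_nbhs R)); last exact: cvgr_expR.
  exact: gt0_cvgMry.
- exact/cvg_at_right_filter/cF.
- by move=> t _; rewrite derive1E; have [] := DF t.
Qed.

Lemma integrable_exp_decay : mu.-integrable (@Rplus_set R)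
  (EFin \o (fun t => kappa * expR (- kappa * t))).
Proof.
apply/integrableP; split.
  by apply/measurable_EFinP/measurable_funTS; exact: (continuous_measurable_fun cf).
under eq_integral => t _ do
  rewrite /= ger0_norm ?(mulr_ge0 (ltW kappa0) (expR_ge0 (- kappa * t)))//.
by rewrite integral_exp_decay ltry.
Qed.

Lemma Rintegral_exp_decay_interval t : 0 <= t ->
  \int[mu]_(s in interval0 t) (kappa * expR (- kappa * s)) = 1 - expR (- kappa * t).
Proof.
rewrite le_eqVlt => /predU1P[<-|t0].
  rewrite interval0E set_itv1 Rintegral_set1 mulr0 expR0 subrr//.
rewrite interval0E /Rintegral (@continuous_FTC2 R f F 0 t)//.
- by rewrite /F/= mulr0 expR0 opprK addrC.
- exact: continuous_subspaceT.
- split=> [s _| |]; first by have [] := DF s.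
    exact/cvg_at_right_filter/cF.
  exact/cvg_at_left_filter/cF.
- by move=> s _; rewrite derive1E; have [] := DF s.
Qed.

End ExponentialIntegrals.

Section IntegralHalfLine.
Variable R : realType.
Local Notation mu := (@lebesgue_measure R).
Local Notation mR := (measurableTypeR R).

(** Monotone convergence along [[0, n]]; it carries the budget constraint from finite horizons to
    the whole half-line. *)
Lemma integral_Rplus_le (w : R -> R) (I : R) :
  (forall t, 0 <= t -> 0 <= w t) ->
  measurable_fun (@Rplus_set R : set mR) w ->
  (forall t, 0 <= t -> mu.-integrable (interval0 t) (EFin \o w)) ->
  (forall t, 0 <= t -> \int[mu]_(s in interval0 t) w s <= I) ->
  (\int[mu]_(t in Rplus_set) (w t)%:E <= I%:E)%E.
Proof.
move=> w0 mw iw wI.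
pose D (n : nat) : set mR := interval0 n%:R.
have bigD : \bigcup_n D n = @Rplus_set R.
  apply/seteqP; split=> [t [n _ /andP[]]//|t t0].
  exists (Num.truncn t).+1 => //=.
  by apply/andP; split=> //; exact: ltW (truncnS_gt _).
have mD n : measurable (D n) := measurable_interval0 _.
rewrite -bigD.
have cv : (\int[mu]_(t in D n) (w t)%:E @[n --> \oo] -->
    \int[mu]_(t in \bigcup_n D n) (w t)%:E)%E.
  apply: (@ge0_nondecreasing_set_cvg_integral _ _ R D (EFin \o w) mu) => //.
  - move=> m n mn; apply/subsetPset => t /andP[t0 tm]; apply/andP; split => //.
    by apply: le_trans tm _; rewrite ler_nat.
  - move=> n; apply/measurable_EFinP; apply: measurable_funS mw.
      exact: measurable_Rplus_set.
    exact: interval0_sub.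
  - by move=> n t /andP[t0 _]; rewrite lee_fin w0.
apply: (cvge_le _ cv).
near=> n; have n0 : 0 <= n%:R :> R by [].
have := wI _ n0; rewrite -lee_fin /Rintegral fineK//.
exact: (integrable_fin_num (mD n) (iw _ n0)).
Unshelve. all: by end_near. Qed.

End IntegralHalfLine.

(** * Real powers and the tangent inequality for the utility *)

Section PowerFunctions.
Variable R : realType.

Lemma powR_expR (u r : R) : expR u `^ r = expR (r * u).
Proof. by rewrite /powR gt_eqF ?expR_gt0// expRK. Qed.

(** Writing positive quantities as exponentials turns identities between real powers into linear
    identities between exponents. *)
Lemma gt0_expR (x : R) : 0 < x -> exists u, x = expR u.
Proof. by move=> x0; exists (ln x); rewrite lnK. Qed.

Lemma Xsp_powR (f : R -> R) (r : R) : Xsp f -> (forall th, 0 < f th) ->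
  Xsp (fun th => f th `^ r).
Proof.
move=> [cf pf] f0; split=> [th|th]; last by rewrite pf.
rewrite (_ : (fun th => _) = (fun th => expR (r * ln (f th)))); last first.
  by apply/funext => u; rewrite /powR gt_eqF.
apply: continuous_comp; last exact: continuous_expR.
apply: cvgMr; apply: (continuous_comp (cf th)); exact: continuous_ln.
Qed.

Lemma Rintegral_S1_gt0 (f : R -> R) : continuous f -> (forall th, 0 < f th) ->
  0 < \int[@lebesgue_measure R]_(th in S1) f th.
Proof.
move=> cf f0.
have [c _ Hc] := EVT_min (ltW (two_pi_gt0 R))
  (@continuous_subspaceT _ _ `[0, 2 * pi]%classic _ cf).
apply: (@lt_le_trans _ _ (\int[@lebesgue_measure R]_(th in S1) f c)).
  rewrite Rintegral_cst; last exact: measurable_S1.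
  rewrite mulr_gt0// [X in fine X](_ : _ = (2 * pi)%:E) ?two_pi_gt0//.
  exact: lebesgue_measure_S1.
apply: le_Rintegral.
- exact: measurable_S1.
- by apply: (@integrable_S1 R (cst (f c))) => th; exact: cvg_cst.
- exact: integrable_S1.
- by move=> th Sth; apply: Hc; move: Sth; rewrite /S1/= in_itv.
Qed.

Lemma util_tangent (gamma c chat : R) : 0 < gamma -> gamma != 1 -> 0 <= c -> 0 < chat ->
  (util gamma c <=
    (gamma / (1 - gamma) * chat `^ (1 - gamma) + chat `^ (- gamma) * c)%:E)%E.
Proof.
move=> g0 g1 c0 /gt0_expR[v ->]; rewrite /util.
have gn : 1 - gamma != 0 by rewrite subr_eq0 eq_sym.
have [->|cn0] := eqVneq c 0.
  (* At zero consumption the utility is [-oo] for [gamma > 1], and 0 for [gamma < 1], where the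
     tangent value is nonnegative. *)
  case: ltP => /= [_|gle]; first exact: leNye.
  have {g1 gle}glt : gamma < 1 by rewrite lt_neqAle g1.
  rewrite powR0// mul0r mulr0 addr0 lee_fin mulr_ge0 ?powR_ge0// divr_ge0; lra.
have : 0 < c by rewrite lt_def cn0.
move=> /gt0_expR[u ->] /=; rewrite !powR_expR lee_fin -expRD.
set P := expR ((1 - gamma) * v).
have P0 : 0 < P := expR_gt0 _.
pose w := u - v.
have -> : expR ((1 - gamma) * u) = P * expR ((1 - gamma) * w).
  by rewrite -expRD; congr expR; rewrite /w; ring.
have -> : expR (- gamma * v + u) = P * expR w.
  by rewrite -expRD; congr expR; rewrite /w; ring.
rewrite [gamma / _ * P]mulrC -mulrA -mulrDr ler_pM2l//.
(* For [gamma < 1] the claim is convexity of the exponential, [expR ((1 - gamma) * w) <= gamma + (1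
   - gamma) * expR w], from the tangent at the barycentre [m] of 0 and [w]. For [gamma > 1] the sign
   flips, and adding two tangent inequalities at 0 is enough. *)
case: (ltgtP gamma 1) g1 => // gl _.
  have g10 : 0 < 1 - gamma by lra.
  rewrite -(ler_pM2r g10) [in X in _ <= X]mulrDl !divfK//.
  set m := (1 - gamma) * w; have m0 := expR_gt0 m.
  have h1 : expR m * (1 - m) <= 1.
    by rewrite -ler_pdivlMl// mulr1 -expRN expR_ge1Dx.
  have h2 : expR m * (1 + (w - m)) <= expR w.
    by rewrite -ler_pdivlMl// -expRN -expRD [X in expR X]addrC expR_ge1Dx.
  have h1' := ler_wpM2l (ltW g0) h1; have h2' := ler_wpM2l (ltW g10) h2.
  move: h1' h2'; rewrite /m; move: (expR ((1 - gamma) * w)) => X; lra.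
have g10 : 1 - gamma < 0 by lra.
rewrite -(ler_nM2r g10) [in X in X <= _]mulrDl !divfK//.
have h1 := expR_ge1Dx ((1 - gamma) * w); have h2 := expR_ge1Dx w.
have g11 : 0 <= gamma - 1 by lra.
have := ler_wpM2l g11 h2; lra.
Qed.

End PowerFunctions.

Section PairingIntegral.
Variable R : realType.
Local Notation mu := (@lebesgue_measure R).

Lemma pairingZ (b x : R -> R) (c : R) : Xsp b -> Xsp x ->
  pairing b (fun th => c * x th) = c * pairing b x.
Proof.
move=> Xb Xx; rewrite /pairing -RintegralZl//; last 2 first.
- exact: measurable_S1.
- exact: integrable_pairing.
by apply: eq_Rintegral => th _; rewrite mulrA.
Qed.

Lemma integral_pairingE (b x : R -> R) : Xsp b -> Xsp x ->
  (\int[mu]_(th in S1) (x th * b th)%:E = (pairing b x)%:E)%E.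
Proof.
move=> Xb Xx; rewrite /pairing /Rintegral fineK//.
exact: (integrable_fin_num (@measurable_S1 R) (integrable_pairing Xb Xx)).
Qed.

End PairingIntegral.

(** * Verification of a candidate satisfying budget and first-order conditions *)

Section Verification.
Variables (R : realType) (sigma : R) (A : R -> R) (S : R -> (R -> R) -> R -> R).
Hypotheses (XA : Xsp A) (HS : IsSemigroupOf sigma A S).
Variables (lambda0 : R) (b0 : R -> R).
Hypothesis Hb : IsPrincipalEigen sigma A lambda0 b0.
Variables (eta K0 : R -> R) (q gamma rho : R).
Hypotheses (Xeta : Xsp eta) (eta0 : forall th, 0 < eta th) (XK0 : Xsp K0).
Hypotheses (gamma0 : 0 < gamma) (gamma1 : gamma != 1).
Local Notation mu := (@lebesgue_measure R).
Local Notation mR := (measurableTypeR R).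

(** [g] is the growth rate, [kappa] the share of aggregated capital spent per unit time, and [m] the
    multiplier of the budget constraint. The spatial profile [chat] enters through its budget and
    first-order identities, so its explicit powers stay out of the verification. *)
Variables (g kappa m : R) (chat : R -> R).
Hypotheses (gE : gamma * g = lambda0 - rho) (kappaE : kappa = lambda0 - g).
Hypotheses (kappa0 : 0 < kappa) (m0 : 0 < m) (I00 : 0 < pairing b0 K0).
Hypotheses (Xchat : Xsp chat) (chat0 : forall th, 0 < chat th).
Hypothesis budget_chat :
  pairing b0 (fun th => eta th * chat th) = kappa * pairing b0 K0.
(* First-order condition: marginal utility is m times the price [eta b0]. *)
Hypothesis foc_chat : forall th,
  eta th `^ q * chat th `^ (- gamma) = m * (eta th * b0 th).

Local Notation Chat := (fun t th : R => chat th * expR (g * t)).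
Local Notation I0 := (pairing b0 K0).

Let Xb : Xsp b0 := b0_Xsp Hb.

Let Xec : Xsp (fun th => eta th * chat th) := XspM Xeta Xchat.

Let gamman : 1 - gamma != 0. Proof. by rewrite subr_eq0 eq_sym. Qed.

Lemma Chat_L1loc_plus : L1loc_plus Chat.
Proof.
have cexp : continuous (fun t : R => expR (g * t)).
  move=> t; apply: (@continuous_comp _ _ _ (fun s => g * s) expR); last exact: continuous_expR.
  by apply: cvgMr; exact: cvg_id.
split=> [t t0|].
  split=> [|th]; last by rewrite mulr_ge0 ?expR_ge0// ltW.
  exact: XspM Xchat (Xsp_cst _).
split=> [th|T T0].
  apply: measurable_funTS; apply: continuous_measurable_fun => t.
  by apply: cvgMr; exact: cexp.
have [B B0 cB] := Xsp_bounded Xchat.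
exists (fun t => B * expR (g * t)); split.
  rewrite interval0E; apply: continuous_compact_integrable; first exact: segment_compact.
  by apply: continuous_subspaceT => t; apply: cvgMr; exact: cexp.
move=> t th _; rewrite ler_wpM2r ?expR_ge0//.
by apply: le_trans (cB th); exact: ler_norm.
Qed.

Lemma pairing_Chat s :
  pairing b0 (fun xi => eta xi * (chat xi * expR (g * s))) = kappa * I0 * expR (g * s).
Proof.
rewrite -budget_chat [RHS]mulrC -pairingZ//; congr pairing.
by apply/funext => th; rewrite mulrA mulrC.
Qed.

(** At time [t] a fraction [expR (- kappa * t)] of the discounted budget is left, and
    [lambda0 - kappa = g]. The budget is exhausted only in the limit, which keeps the aggregate
    strictly positive. *)
Lemma pairing_capital_Chat t : 0 <= t ->
  \int[mu]_(th in S1) (capital S eta K0 Chat t th * b0 th) = I0 * expR (g * t).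
Proof.
move=> t0; rewrite (pairing_capital XA HS Hb Xeta Chat_L1loc_plus XK0 t0).
have -> : \int[mu]_(s in interval0 t) (expR (- lambda0 * s) *
    pairing b0 (fun xi => eta xi * (chat xi * expR (g * s)))) =
    I0 * (1 - expR (- kappa * t)).
  rewrite -(Rintegral_exp_decay_interval kappa t0) -RintegralZl//; last 2 first.
  - exact: measurable_interval0.
  - apply: (integrableS (@measurable_Rplus_set R)).
    + exact: measurable_interval0.
    + exact: interval0_sub.
    + exact: integrable_exp_decay.
  apply: eq_Rintegral => s _; rewrite pairing_Chat kappaE.
  rewrite (_ : - (lambda0 - g) * s = - lambda0 * s + g * s); last by ring.
  by rewrite expRD; ring.
rewrite kappaE (_ : g * t = lambda0 * t + - (lambda0 - g) * t); last by ring.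
by rewrite expRD; ring.
Qed.

Lemma Chat_admissible : admissible_b0 S eta b0 K0 Chat.
Proof.
split=> [|t t0]; first exact: Chat_L1loc_plus.
by rewrite pairing_capital_Chat// mulr_gt0// expR_gt0.
Qed.

Lemma foc_Chat t th : eta th `^ q * (chat th * expR (g * t)) `^ (- gamma) =
  m * expR ((rho - lambda0) * t) * (eta th * b0 th).
Proof.
rewrite powRM ?expR_ge0 ?(ltW (chat0 th))// powR_expR mulrA foc_chat.
rewrite (_ : - gamma * (g * t) = (rho - lambda0) * t); first by ring.
by rewrite mulrA mulNr gE opprB.
Qed.

Lemma Chat_powR t th : (chat th * expR (g * t)) `^ (1 - gamma) =
  (chat th * expR (g * t)) * (chat th * expR (g * t)) `^ (- gamma).
Proof.
have c0 : 0 < chat th * expR (g * t) by rewrite mulr_gt0// expR_gt0.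
rewrite powRD ?powRr1 ?(ltW c0)//.
by apply/implyP => _; rewrite gt_eqF.
Qed.

Let discount t : expR (- (rho * t)) * (expR ((rho - lambda0) * t) * expR (g * t)) =
  expR (- kappa * t).
Proof. by rewrite -!expRD; congr expR; rewrite kappaE; ring. Qed.

(** Splitting off one factor of consumption and applying the first-order condition makes discounted
    utility equal to [m / (1 - gamma)] times spending at market prices, whose total is [I0]. *)
Lemma Jfun_Chat : Jfun rho gamma q eta Chat = (m * I0 / (1 - gamma))%:E.
Proof.
rewrite /Jfun.
transitivity (\int[mu]_(t in Rplus_set)
    ((m * I0 / (1 - gamma))%:E * (kappa * expR (- kappa * t))%:E))%E; last first.
  rewrite integralZl//; last 2 first.
  - exact: measurable_Rplus_set.
  - exact: integrable_exp_decay.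
  by rewrite integral_exp_decay// mule1.
apply: eq_integral => t _.
pose k := m / (1 - gamma) * expR ((rho - lambda0) * t) * expR (g * t).
transitivity ((expR (- (rho * t)))%:E *
    \int[mu]_(th in S1) ((k * (eta th * chat th)) * b0 th)%:E)%E.
  congr (_ * _)%E; apply: eq_integral => th _.
  have c0 : 0 < chat th * expR (g * t) by rewrite mulr_gt0// expR_gt0.
  rewrite /util gt_eqF//= -EFinM Chat_powR; congr EFin.
  set P := (_ * _) `^ (- gamma).
  rewrite (_ : _ * eta th `^ q =
    chat th * expR (g * t) / (1 - gamma) * (eta th `^ q * P)); last by ring.
  by rewrite /P foc_Chat /k; ring.
rewrite integral_pairingE//; last exact: XspZ.
rewrite pairingZ// budget_chat -!EFinM; congr EFin.
by rewrite -discount /k; ring.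
Qed.

Lemma Jfun_le C : admissible_b0 S eta b0 K0 C ->
  (Jfun rho gamma q eta C <= (m * I0 / (1 - gamma))%:E)%E.
Proof.
move=> [HC adm].
have XC t : 0 <= t -> Xsp (fun th => eta th * C t th).
  exact: effective_consumption_Xsp Xeta HC _.
have C0 t th : 0 <= t -> 0 <= C t th by move=> t0; have [/(_ t t0)[_]] := HC; exact.
pose W t := expR (- lambda0 * t) * pairing b0 (fun th => eta th * C t th).
have W0 t : 0 <= t -> 0 <= W t.
  move=> t0; rewrite mulr_ge0 ?expR_ge0//; apply: Rintegral_ge0 => th _.
  by rewrite !mulr_ge0 ?C0// ltW//; exact: (b0_gt0 Hb).
have WI t : 0 <= t -> \int[mu]_(s in interval0 t) W s <= I0.
  move=> t0; have := adm t t0.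
  rewrite (pairing_capital XA HS Hb Xeta HC XK0 t0) pmulr_rgt0 ?expR_gt0//.
  by rewrite subr_gt0 => /ltW.
have mW : measurable_fun (@Rplus_set R : set mR) W.
  apply: measurable_funM; last exact: (measurable_pairing_consumption Hb Xeta HC).
  apply: measurable_funTS; apply: continuous_measurable_fun => s.
  apply: (@continuous_comp _ _ _ (fun s => - lambda0 * s) expR); last exact: continuous_expR.
  by apply: cvgMr; exact: cvg_id.
have intW : (\int[mu]_(t in Rplus_set) (W t)%:E <= I0%:E)%E.
  apply: integral_Rplus_le => // t t0.
  exact: (integrable_pairing_consumption Hb Xeta HC).
(* For [gamma > 1] the constant [c1] below is negative, so the bound is split by additivity for
   integrable functions rather than for nonnegative ones. *)
have iW : mu.-integrable (@Rplus_set R) (EFin \o W).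
  apply/integrableP; split; first exact/measurable_EFinP.
  apply: le_lt_trans (ltry I0); apply: le_trans intW.
  by apply: le_integral_pointwise => t t0; rewrite /= lee_fin ger0_norm// W0.
(* [c1] collects the constant terms of the tangent bound and [m * W t] the linear one. As [gamma /
   (1 - gamma) + 1 = 1 / (1 - gamma)], spending at most [I0] yields at most the candidate's
   value. *)
pose c1 := gamma / (1 - gamma) * m * I0.
apply: (@le_trans _ _ (\int[mu]_(t in Rplus_set)
    (c1%:E * (kappa * expR (- kappa * t))%:E + m%:E * (W t)%:E))%E); last first.
  rewrite integralD//; last 3 first.
  - exact: measurable_Rplus_set.
  - apply: integrableZl; first exact: measurable_Rplus_set.
    exact: integrable_exp_decay.
  - by apply: integrableZl => //; exact: measurable_Rplus_set.
  rewrite !integralZl//; try exact: measurable_Rplus_set.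
    rewrite integral_exp_decay// mule1.
    apply: (@le_trans _ _ (c1%:E + m%:E * I0%:E)%E).
      by rewrite leeD2l// lee_wpmul2l// lee_fin ltW.
    rewrite -EFinM -EFinD lee_fin /c1.
    by rewrite (_ : _ + _ = m * I0 / (1 - gamma))//; field.
  exact: integrable_exp_decay.
apply: le_integral_pointwise => t t0.
pose k2 := m * expR ((rho - lambda0) * t).
pose k1 := gamma / (1 - gamma) * k2 * expR (g * t).
apply: (@le_trans _ _ ((expR (- (rho * t)))%:E * \int[mu]_(th in S1)
    ((k1 * (eta th * chat th) + k2 * (eta th * C t th)) * b0 th)%:E)%E).
  apply: lee_wpmul2l; first by rewrite lee_fin expR_ge0.
  apply: le_integral_pointwise => th _.
  have c0 : 0 < chat th * expR (g * t) by rewrite mulr_gt0// expR_gt0.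
  apply: le_trans (lee_wpmul2r _ (util_tangent gamma0 gamma1 (C0 t th t0) c0)) _.
    by rewrite lee_fin powR_ge0.
  rewrite -EFinM lee_fin Chat_powR.
  set P := (_ * _) `^ (- gamma).
  rewrite (_ : _ * eta th `^ q = (gamma / (1 - gamma) * (chat th * expR (g * t)) + C t th) *
    (eta th `^ q * P)); last by ring.
  by rewrite /P foc_Chat -/k2 /k1 le_eqVlt; apply/orP; left; apply/eqP; ring.
rewrite integral_pairingE//; last first.
  by apply: Xsp_lin => //; apply: XspZ; exact: XC.
rewrite pairing_linear//; [|by apply: XspZ; exact: XC].
rewrite pairingZ//; [|exact: XC].
rewrite budget_chat -!EFinM -EFinD lee_fin le_eqVlt; apply/orP; left; apply/eqP.
rewrite -discount /W.
rewrite (_ : - lambda0 * t = - (rho * t) + (rho - lambda0) * t); last by ring.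
rewrite expRD /c1 /k1 /k2; ring.
Qed.

Lemma Vb0E : Vb0 S rho gamma q eta b0 K0 = (m * I0 / (1 - gamma))%:E.
Proof.
apply/eqP; rewrite eq_le; apply/andP; split.
  by apply: ge_ereal_sup => _ [C HC <-]; exact: Jfun_le.
by rewrite -Jfun_Chat; apply: ereal_sup_ubound; exists Chat => //; exact: Chat_admissible.
Qed.

End Verification.

Unset Implicit Arguments.
Set Strict Implicit.

(** * The explicit candidate *)

Theorem theorem5p7 (R : realType) (sigma : R) (A eta : R -> R) (q gamma rho : R)
  (lambda0 : R) (b0 : R -> R) (S : R -> (R -> R) -> (R -> R)) (K0 : R -> R) :
  0 < sigma ->
  Xsp A -> (forall th, 0 < A th) ->
  Xsp eta -> (forall th, 0 < eta th) ->
  0 <= q -> 0 < gamma -> gamma != 1 -> 0 < rho ->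
  IsPrincipalEigen sigma A lambda0 b0 ->
  IsSemigroupOf sigma A S ->
  rho > lambda0 * (1 - gamma) ->
  Xsp K0 -> (forall th, 0 < K0 th) ->
  let I0 := \int[lebesgue_measure]_(th in S1) (K0 th * b0 th) in
  let alpha := (gamma / (rho - lambda0 * (1 - gamma)) *
        \int[lebesgue_measure]_(th in S1)
          (eta th `^ ((q + gamma - 1) / gamma) * b0 th `^ ((gamma - 1) / gamma)))
        `^ gamma in
  let g := (lambda0 - rho) / gamma in
  let Chat := fun t th =>
      I0 * (alpha * b0 th) `^ (- gamma^-1) * eta th `^ ((q - 1) / gamma) * expR (g * t) in
  let Khat := capital S eta K0 Chat in
  (* (i) *)
  Vb0 S rho gamma q eta b0 K0 = (alpha / (1 - gamma) * I0 `^ (1 - gamma))%:E /\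
  (* (ii) optimality of Chat *)
  Chat \in admissible_b0 S eta b0 K0 /\
  Jfun rho gamma q eta Chat = Vb0 S rho gamma q eta b0 K0 /\
  (* Khat is a mild solution of the linear integro-PDE *)
  (forall t th, 0 <= t ->
     Khat t th = S t K0 th -
       \int[lebesgue_measure]_(s in interval0 t)
          S (t - s) (fun xi => (alpha * b0 xi) `^ (- gamma^-1) *
               (\int[lebesgue_measure]_(z in S1) (Khat s z * b0 z)) *
               eta xi `^ ((q + gamma - 1) / gamma)) th).
Proof.
move=> sigma0 XA A0 Xeta eta0 q0 gamma0 gamma1 rho0 Hb HS rhoE XK0 K00 I0 alpha g Chat Khat.
have Xb := b0_Xsp Hb; have b00 := b0_gt0 Hb.
pose kappa := (rho - lambda0 * (1 - gamma)) / gamma.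
pose beta th := eta th `^ ((q + gamma - 1) / gamma) * b0 th `^ ((gamma - 1) / gamma).
pose I1 := \int[lebesgue_measure]_(th in S1) beta th.
have kappa0 : 0 < kappa by rewrite divr_gt0// subr_gt0.
have gn0 : gamma != 0 by rewrite gt_eqF.
have Xbeta : Xsp beta by apply: XspM; exact: Xsp_powR.
have I10 : 0 < I1.
  by apply: Rintegral_S1_gt0; [exact: Xbeta.1|move=> th; rewrite mulr_gt0// powR_gt0].
have I00 : 0 < I0.
  by apply: Rintegral_S1_gt0; [exact: (XspM XK0 Xb).1|move=> th; rewrite mulr_gt0].
have alphaE : alpha = (I1 / kappa) `^ gamma.
  rewrite /alpha -/(beta _) -/I1; congr (_ `^ _).
  by rewrite /kappa invf_div mulrC.
have alpha0 : 0 < alpha by rewrite alphaE powR_gt0// divr_gt0.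
have gE : gamma * g = lambda0 - rho by rewrite /g mulrC divfK.
have kappaE : kappa = lambda0 - g by rewrite /kappa /g; field.
pose chat th := I0 * (alpha * b0 th) `^ (- gamma^-1) * eta th `^ ((q - 1) / gamma).
have Xchat : Xsp chat.
  apply: XspM; last exact: Xsp_powR.
  apply: XspZ; apply: Xsp_powR; first exact: XspZ.
  by move=> th; rewrite mulr_gt0.
have chat0 th : 0 < chat th by rewrite !mulr_gt0// powR_gt0// mulr_gt0.
pose m := alpha * I0 `^ (- gamma).
have m0 : 0 < m by rewrite mulr_gt0// powR_gt0.
(* This identity determines [alpha]: the priced profile is [I0 * alpha]^ (- gamma^-1) *
   beta[, so]alpha [^ (- gamma^-1) * I1] has to equal [kappa]. *)
have budget : pairing b0 (fun th => eta th * chat th) = kappa * pairing b0 K0.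
  rewrite -[pairing b0 K0]/I0.
  transitivity (\int[lebesgue_measure]_(th in S1) (I0 * alpha `^ (- gamma^-1) * beta th)).
    apply: eq_Rintegral => th _; rewrite /chat /beta.
    have [u ->] := gt0_expR (b00 th); have [v ->] := gt0_expR (eta0 th).
    have [a ->] := gt0_expR alpha0; have [i ->] := gt0_expR I00.
    by rewrite -expRD !powR_expR -!expRD; congr expR; field.
  rewrite RintegralZl//; last 2 first.
  - exact: measurable_S1.
  - by apply: integrable_S1; exact: Xbeta.1.
  rewrite -/I1 alphaE -powRrM mulrN divff// (powR_inv1 (ltW (divr_gt0 I10 kappa0))).
  by rewrite invf_div mulrA divfK ?gt_eqF// mulrC.
have foc th : eta th `^ q * chat th `^ (- gamma) = m * (eta th * b0 th).
  rewrite /chat /m.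
  have [u ->] := gt0_expR (b00 th); have [v ->] := gt0_expR (eta0 th).
  have [a ->] := gt0_expR alpha0; have [i ->] := gt0_expR I00.
  by rewrite -expRD !powR_expR -!expRD !powR_expR -!expRD; congr expR; field.
have V := Vb0E XA HS Hb Xeta eta0 XK0 gamma0 gamma1 gE kappaE kappa0 m0 I00 Xchat chat0 budget foc.
have J := Jfun_Chat Hb Xeta gE kappaE kappa0 Xchat chat0 budget foc.
have adm := Chat_admissible XA HS Hb Xeta XK0 kappaE kappa0 I00 Xchat chat0 budget.
split; first (rewrite V; congr EFin).
  rewrite -[pairing b0 K0]/I0 /m.
  have [i ->] := gt0_expR I00.
  rewrite !powR_expR (_ : (1 - gamma) * i = - gamma * i + i); last by ring.
  by rewrite expRD; ring.
split; first by rewrite inE; exact: adm.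
split; first by rewrite V; exact: J.
(* Along [Khat] the aggregate is [I0 * expR (g * s)], so the open-loop control coincides with the
   feedback in the equation; the factor [eta] of the dynamics raises the exponent [(q - 1) / gamma]
   by 1. *)
move=> t th t0; rewrite {1}/Khat /capital; congr (_ - _).
apply: eq_Rintegral => s; rewrite inE => /andP[s0 _].
congr (S _ _ _); apply/funext => xi.
rewrite (pairing_capital_Chat XA HS Hb Xeta XK0 kappaE kappa0 Xchat chat0 budget s0).
rewrite -[pairing b0 K0]/I0 /Chat.
rewrite (_ : (q + gamma - 1) / gamma = (q - 1) / gamma + 1); last by field.
rewrite powRD; last by apply/implyP => _; rewrite gt_eqF.
by rewrite powRr1 ?(ltW (eta0 xi))//; ring.
Qed.
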